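(* Let $\mathcal{L}$ be a fragment of $\mathsf{HDFOLR}$ that is semantically closed under equality, retrieve, negation, disjunction, possibility over binary modalities, and quantifiers. Assume that $\mathcal{L}$ has the $\alpha$-Omitting Types Property, where $\alpha$ is a regular cardinal. Let $T$ be a satisfiable theory over a signature $\Delta$ of power at most $\alpha$. For each model $(W,M)$ of $T$ there exists another model $(V,N)$ of $T$ such that $\mathrm{card}((V,N)_s)\geq\alpha$ for all sorts $s\in S^e$. In fact, if $\Delta'$ is obtained from $\Delta$ by adding a rigid binary relation $\leq$ on each sort $s\in S^e$ interpreted by $(W,M)$ as infinite, then there exists an expansion $(V',N')$ of $(V,N)$ to $\Delta'$ such that $\langle (V',N')_s,(V',N')_{\leq}\rangle$ is a linear ordering of cofinality $\alpha$ for all sorts $s\in S^e$.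
   Context: **The logic HDFOLR.** A first-order signature is $\Sigma=(S,F,P)$ with sorts $S$, function symbols $F=\{F_{ar\to s}\}_{(ar,s)\in S^*\times S}$ and relation symbols $P=\{P_{ar}\}_{ar\in S^*}$; its structures interpret each sort as a non-empty set. An $\mathsf{HDFOLR}$ signature is $\Delta=(\Sigma^n,\Sigma^r\subseteq\Sigma)$ where $\Sigma^n=(\{any\},F^n,P^n)$ is single-sorted, with $F^n$ a set of constants (nominals) and $P^n$ a set of binary relation symbols (modalities), $\Sigma=(S,F,P)$ is a many-sorted first-order signature, and $\Sigma^r=(S^r,F^r,P^r)$ is a subsignature of rigid symbols; the other symbols and sorts of $\Sigma$ are flexible. Put $S^e=S^r\cup\{any\}$. The power of $\Delta$ is the maximum of $\omega$ and the number of its symbols. Signature morphisms are pairs of first-order signature morphisms $\Sigma^n\to\Sigma_1^n$, $\Sigma\to\Sigma_1$, the second mapping $\Sigma^r$ into $\Sigma_1^r$. For a set $C=\{C_s\}_{s\in S^e}$ of new constants (or variables), $\Delta[C]$ is $\Delta$ with $C_{any}$ added to $F^n$ and the $C_s$, $s\in S^r$, added to $F^r$. A rigid binary relation on the sort $any$ means a binary modality. A Kripke structure over $\Delta$ is $(W,M)$ where $W$ is a $\Sigma^n$-structure with non-empty universe $|W|$ of worlds and $M$ assigns to each $w\in|W|$ a first-order $\Sigma$-structure $M_w$ such that all $M_w$ have the same reduct to $\Sigma^r$. For $s\in S^e$, $(W,M)_s$ is $|W|$ if $s=any$ and the common set $M_{w,s}$ if $s\in S^r$; similarly $(W,M)_\leq$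 denotes the interpretation of a modality or rigid relation symbol $\leq$. Expansions and reducts are as usual. Actions: $a::=\lambda\mid a;a\mid a\cup a\mid a^*$ with $\lambda\in P^n$, interpreted by relational composition, union and reflexive-transitive closure; $a^n$ is $n$-fold composition, and $\langle a^0\rangle\gamma$ means $\gamma$. For $k\in F^n$ each symbol (sort, function, relation) $x$ of $\Sigma$ yields a symbol $@_kx$, with $@_kx:=x$ if $x$ is rigid, and with $@_k\sigma:@_k ar\to @_k s$ for $\sigma:ar\to s$, similarly for relations. Rigid terms are terms over the signature $@\Sigma$ of all symbols $@_kx$. Hybrid terms are terms over $\overline\Sigma$, which consists of $\Sigma$ together with all $@_kx$, $x$ flexible; $T_{\overline\Sigma}$ is the set of hybrid terms. In a world $w$: $M_{w,\sigma(t)}=M_{w,\sigma}(M_{w,t})$, $M_{w,(@_k\sigma)(t)}=M_{W_k,\sigma}(M_{w,t})$, and $@_k\pi$ is interpreted as $M_{W_k,\pi}$. Sentences over $\Delta$: $\gamma::=k\mid t_1=t_2\mid\pi(t)\mid @_k\gamma\mid\neg\gamma\mid\vee\Gamma\mid{\downarrow}z\cdot\gamma'\mid\exists X\cdot\gamma''\mid\langle a\rangle\gamma$, with $k\in F^n$, $t_1,t_2$ hybrid terms of the same sort, $\pi$ a relation symbol of $\overline\Sigma$ and $t$ a tuple of hybrid terms of its arity, $\Gamma$ a finite set of sentences, $z$ a nominal variable and $\gamma'$ a $\Delta[z]$-sentence, $X$ a finite set of variables with sorts in $S^e$ and $\gamma''$ a $\Delta[X]$-sentence, $a$ an action. Operators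 are called retrieve ($@$), negation, disjunction, store (${\downarrow}$), existential quantification, possibility. Local satisfaction: $(W,M)\models^w k$ iff $W_k=w$; equations and relations are evaluated in $M_w$; $\models^w @_k\gamma$ iff $\models^{W_k}\gamma$; $\neg,\vee$ as usual; $(W,M)\models^w{\downarrow}z\cdot\gamma$ iff $(W^{z\leftarrow w},M)\models^w\gamma$ (the expansion interpreting $z$ as $w$); $(W,M)\models^w\exists X\cdot\gamma$ iff some expansion to $\Delta[X]$ satisfies $\gamma$ at $w$; $\models^w\langle a\rangle\gamma$ iff $\models^{w'}\gamma$ for some $w'$ with $(w,w')\in W_a$. Global satisfaction $(W,M)\models\gamma$ means $(W,M)\models^w\gamma$ for all $w$; $(W,M)\models\Gamma$ means this for all $\gamma\in\Gamma$, and then $(W,M)$ is called a model of $\Gamma$; $T\models\Gamma$ means every model of $T$ is a model of $\Gamma$; a set of sentences is satisfiable if it has a model. A substitution $\theta:C_1\to C_2$ over $\Delta$ maps each new constant in $C_1$ of sort $any$ to a nominal of $\Delta[C_2]$ and each new constant of rigid sort $s$ to a rigid term of sort $s$ over $\Delta[C_2]$; it extends to a map $\gamma\mapsto\theta(\gamma)$ from $\Delta[C_1]$-sentences to $\Delta[C_2]$-sentences. **Fragments.** A fragment $\mathcal{L}$ consists of a subcategory $\mathrm{Sig}^{\mathcal L}$ of the category of $\mathsf{HDFOLR}$ signatures and a subfunctor $\mathrm{Sen}$ of the $\mathsf{HDFOLR}$ sentence functor on it (same Kripke structures) such that: (1) for $\Delta\in\mathrm{Sig}^{\mathcal L}$ and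 sets $C$, $D$ of new nominals and new rigid constants, the inclusion $\Delta\hookrightarrow\Delta[C,D]$ is in $\mathrm{Sig}^{\mathcal L}$; (2) $\theta(\gamma)\in\mathrm{Sen}(\Delta[C_2,D_2])$ for every substitution $\theta:\langle C_1,D_1\rangle\to\langle C_2,D_2\rangle$ over $\Delta\in\mathrm{Sig}^{\mathcal L}$ and every $\gamma\in\mathrm{Sen}(\Delta[C_1,D_1])$; (3) it is closed under subsentences: $\langle a_1;a_2\rangle\gamma$ or $\langle a_1\cup a_2\rangle\gamma$ in $\mathrm{Sen}(\Delta)$ implies $\langle a_1\rangle\gamma,\langle a_2\rangle\gamma\in\mathrm{Sen}(\Delta)$; $\langle a^*\rangle\gamma\in\mathrm{Sen}(\Delta)$ implies $\langle a^n\rangle\gamma\in\mathrm{Sen}(\Delta)$ for some $n\in\omega$; each of $\langle a\rangle\gamma$, $\neg\gamma$, $@_k\gamma$ in $\mathrm{Sen}(\Delta)$ implies $\gamma\in\mathrm{Sen}(\Delta)$; $\vee\Gamma\in\mathrm{Sen}(\Delta)$ implies $\Gamma\subseteq\mathrm{Sen}(\Delta)$; ${\downarrow}z\cdot\gamma\in\mathrm{Sen}(\Delta)$ implies $\gamma\in\mathrm{Sen}(\Delta[z])$; $\exists X\cdot\gamma\in\mathrm{Sen}(\Delta)$ implies $\gamma\in\mathrm{Sen}(\Delta[X])$. Signatures, sentences and theories (sets of sentences) in the claim are those of $\mathcal L$. $\mathcal{L}$ is semantically closed under a sentence-building operator if the result of applying it to $\mathcal{L}$-sentences is always satisfied at the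 same worlds of the same Kripke structures as some $\mathcal{L}$-sentence. It is semantically closed under equality if for every nominal $k$ some $\mathcal{L}$-sentence holds at $w$ exactly when $w=W_k$, and for all $t_1,t_2\in T_{\overline\Sigma}$ of the same sort some $\mathcal{L}$-sentence holds at $w$ exactly when $M_{w,t_1}=M_{w,t_2}$. **Omitting types.** Let $X=\{X_s\}_{s\in S^e}$ be variables for $\Delta$ with every $X_s$ finite and $\Gamma\subseteq\mathrm{Sen}(\Delta[X])$ (a type). A Kripke structure $(W,M)$ over $\Delta$ realizes $\Gamma$ if some expansion of it to $\Delta[X]$ globally satisfies $\Gamma$; otherwise it omits $\Gamma$. A theory $T\subseteq\mathrm{Sen}(\Delta)$ $\alpha$-realizes $\Gamma$ if there are a set $C=\{C_s\}_{s\in S^e}$ of new constants with $\mathrm{card}(C_s)<\alpha$ for all $s$, a substitution $\theta:X\to C$ over $\Delta$, and $p\subseteq\mathrm{Sen}(\Delta[C])$ with $\mathrm{card}(p)<\alpha$, such that $T\cup p$ is satisfiable and $T\cup p\models\theta(\Gamma)$; otherwise $T$ $\alpha$-omits $\Gamma$. For an infinite cardinal $\alpha$, $\mathcal{L}$ has the $\alpha$-Omitting Types Property if for every signature $\Delta$ of $\mathcal L$ of power at most $\alpha$, every satisfiable $T\subseteq\mathrm{Sen}(\Delta)$ and every family of types $\{\Gamma^i\subseteq\mathrm{Sen}(\Delta[X^i])\mid i<\alpha\}$ (each $X^i_s$ finite) such that $T$ $\alpha$-omits $\Gamma^i$ for all $i<\alpha$, there is a Kripke structure over $\Delta$ that globally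 satisfies $T$ and omits $\Gamma^i$ for all $i<\alpha$.
   Formalization: The bound card((V,N)_s) ≥ α and the linear orderings are claimed only for sorts s that (W,M) interprets as infinite, not for all s in S^e; otherwise the claim fails, e.g. for a theory saying that a sort has exactly one element. *)

(* Defs.v *)
From mathcomp Require Import all_boot.
From mathcomp Require Import boolp classical_sets functions cardinality.
From Stdlib Require Import Relation_Operators.

Set Implicit Arguments.
Unset Strict Implicit.
Unset Printing Implicit Defensive.

Local Open Scope classical_set_scope.
Local Open Scope card_scope.

(** * Signatures

    Words over a set [S] of sorts are functions ['I_n -> S].  The many-sorted
    signature with its rigid subsignature is given as the disjoint union of a
    rigid part (whose arities use rigid sorts only) and a flexible part (whose
    arities may use all sorts).  Rigid constants, i.e. rigid function symbols
    with empty arity, are kept apart from the rigid function symbols with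
    nonempty arity, because they are what [ext] below adds to a signature. *)

Record signature := Signature {
  nom : Type;
  modal : Type;
  rsort : Type;
  rcst : rsort -> Type;
  rfun : forall n, ('I_n.+1 -> rsort) -> rsort -> Type;
  rrel : forall n, ('I_n -> rsort) -> Type;
  flsort : Type;
  flfun : forall n, ('I_n -> rsort + flsort) -> rsort + flsort -> Type;
  flrel : forall n, ('I_n -> rsort + flsort) -> Type
}.

Arguments rcst : clear implicits.

Definition srt (D : signature) : Type := (rsort D + flsort D)%type.

(** Rigid sorts together with the sort [any], which is [None]. *)
Definition esort (D : signature) : Type := option (rsort D).

Inductive symbol (D : signature) : Type :=
| SymNom of nom D
| SymModal of modal D
| SymSort of srt D
| SymRcst s of rcst D s
| SymRfun n (a : 'I_n.+1 -> rsort D) s of rfun a s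
| SymRrel n (a : 'I_n -> rsort D) of rrel a
| SymFlfun n (a : 'I_n -> srt D) s of flfun a s
| SymFlrel n (a : 'I_n -> srt D) of flrel a.

(** The signature obtained by adding new nominals [C None] and new rigid
    constants [C (Some s)]. *)
Definition ext (D : signature) (C : esort D -> Type) : signature :=
  {| nom := (nom D + C None)%type;
     modal := modal D;
     rsort := rsort D;
     rcst := fun s => (rcst D s + C (Some s))%type;
     rfun := @rfun D;
     rrel := @rrel D;
     flsort := flsort D;
     flfun := @flfun D;
     flrel := @flrel D |}.

(** Finitely many variables, the [i]-th one having sort [X i], as a sorted
    family. *)
Inductive fam (S : Type) (n : nat) (X : 'I_n -> S) : S -> Type :=
| Var (i : 'I_n) : fam X (X i).

Definition znom (D : signature) (s : esort D) : Type :=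
  if s is Some _ then Empty_set else unit.

(** * Signature morphisms *)

(** All function symbols of a given arity and sort, rigid or flexible. *)
Inductive funsym (D : signature) :
    forall n, ('I_n -> srt D) -> srt D -> Type :=
| FunsymC (a : 'I_0 -> srt D) s (r : rsort D) (c : rcst D r) (es : s = inl r) :
    funsym a s
| FunsymR n (a : 'I_n.+1 -> srt D) s (b : 'I_n.+1 -> rsort D) (r : rsort D)
    (f : rfun b r) (ea : forall i, a i = inl (b i)) (es : s = inl r) : funsym a s
| FunsymF n (a : 'I_n -> srt D) s (f : flfun a s) : funsym a s.

Inductive relsym (D : signature) : forall n, ('I_n -> srt D) -> Type :=
| RelsymR n (a : 'I_n -> srt D) (b : 'I_n -> rsort D)
    (p : rrel b) (ea : forall i, a i = inl (b i)) : relsym a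
| RelsymF n (a : 'I_n -> srt D) (p : flrel a) : relsym a.

(** The action of a morphism on everything but the rigid constants.  Flexible
    symbols may be sent to rigid ones, rigid symbols only to rigid ones. *)
Record premor (D D' : signature) := Premor {
  mnom : nom D -> nom D';
  mmod : modal D -> modal D';
  mrs : rsort D -> rsort D';
  msrt : srt D -> srt D';
  msrtE : forall r, msrt (inl r) = inl (mrs r);
  mrfun : forall n (a : 'I_n.+1 -> rsort D) s,
    rfun a s -> rfun (fun i => mrs (a i)) (mrs s);
  mrrel : forall n (a : 'I_n -> rsort D), rrel a -> rrel (fun i => mrs (a i));
  mflfun : forall n (a : 'I_n -> srt D) s,
    flfun a s -> funsym (fun i => msrt (a i)) (msrt s);
  mflrel : forall n (a : 'I_n -> srt D), flrel a -> relsym (fun i => msrt (a i))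
}.

Record morphism (D D' : signature) := Morphism {
  mor_pre :> premor D D';
  mor_cst : forall s, rcst D s -> rcst D' (mrs mor_pre s)
}.

Definition ext_incl_pre (D : signature) (C : esort D -> Type) :
    premor D (ext C) :=
  @Premor D (ext C) inl id id id (fun _ => erefl)
    (fun _ _ _ f => f) (fun _ _ p => p)
    (fun _ _ _ f => @FunsymF (ext C) _ _ _ f)
    (fun _ _ p => @RelsymF (ext C) _ _ p).

Definition ext_incl (D : signature) (C : esort D -> Type) : morphism D (ext C) :=
  @Morphism D (ext C) (ext_incl_pre C) (fun _ c => inl c).

Definition id_pre (D : signature) : premor D D :=
  @Premor D D id id id id (fun _ => erefl)
    (fun _ _ _ f => f) (fun _ _ p => p)
    (fun _ _ _ f => FunsymF f) (fun _ _ p => RelsymF p).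

Definition id_mor (D : signature) : morphism D D :=
  @Morphism D D (id_pre D) (fun _ c => c).

Definition funsym_map (D D' : signature) (m : morphism D D')
    n (a : 'I_n -> srt D) s (f : funsym a s) :
    funsym (fun i => msrt m (a i)) (msrt m s) :=
  match f in @funsym _ n a s
    return funsym (fun i => msrt m (a i)) (msrt m s) with
  | FunsymC a s r c es =>
      FunsymC _ (mor_cst m c) (etrans (congr1 (msrt m) es) (msrtE m r))
  | FunsymR n a s b r f ea es =>
      FunsymR (mrfun m f)
        (fun i => etrans (congr1 (msrt m) (ea i)) (msrtE m (b i)))
        (etrans (congr1 (msrt m) es) (msrtE m r))
  | FunsymF n a s f => mflfun m f
  end.

Definition relsym_map (D D' : signature) (m : premor D D')
    n (a : 'I_n -> srt D) (p : relsym a) : relsym (fun i => msrt m (a i)) :=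
  match p in @relsym _ n a return relsym (fun i => msrt m (a i)) with
  | RelsymR n a b p ea =>
      RelsymR (mrrel m p)
        (fun i => etrans (congr1 (msrt m) (ea i)) (msrtE m (b i)))
  | RelsymF n a p => mflrel m p
  end.

Definition comp_mor (D D' D'' : signature)
    (m' : morphism D' D'') (m : morphism D D') : morphism D D'' :=
  @Morphism D D''
    (@Premor D D''
      (fun k => mnom m' (mnom m k))
      (fun l => mmod m' (mmod m l))
      (fun r => mrs m' (mrs m r))
      (fun s => msrt m' (msrt m s))
      (fun r => etrans (congr1 (msrt m') (msrtE m r)) (msrtE m' (mrs m r)))
      (fun _ _ _ f => mrfun m' (mrfun m f))
      (fun _ _ p => mrrel m' (mrrel m p))
      (fun _ _ _ f => funsym_map m' (mflfun m f))
      (fun _ _ p => relsym_map m' (mflrel m p)))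
    (fun _ c => mor_cst m' (mor_cst m c)).

(** * Terms

    Terms are built over a set [O] of world tags.  A symbol [x] tagged by
    [Some k] (resp. by [k]) stands for [@_k x], one tagged by [None] for [x]
    itself.  Hence hybrid terms are the terms with tags [option (nom D)], and
    rigid terms those with tags [nom D]. *)

Definition tsort (D : signature) (O : Type) : Type :=
  (rsort D + O * flsort D)%type.

Definition at_ (D : signature) (O : Type) (o : O) (s : srt D) : tsort D O :=
  match s with inl r => inl r | inr f => inr (o, f) end.

Inductive term (D : signature) (O : Type) : tsort D O -> Type :=
| TCst s (c : rcst D s) : term (inl s)
| TRig n (a : 'I_n.+1 -> rsort D) s (f : rfun a s)
    (ts : forall i, term (inl (a i))) : term (inl s)
| TFlex (o : O) n (a : 'I_n -> srt D) s (f : flfun a s)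
    (ts : forall i, term (at_ o (a i))) : term (at_ o s).

Definition htag (D : signature) : Type := option (nom D).
Definition hterm (D : signature) (s : tsort D (htag D)) : Type := term s.
Definition rterm (D : signature) (s : rsort D) : Type :=
  @term D (nom D) (inl s).

Section TermTranslation.
Variables (D D' : signature) (m : premor D D') (O O' : Type) (g : O -> O').
Variable rc : forall s, rcst D s -> @term D' O' (inl (mrs m s)).

Definition tr_sort (s : tsort D O) : tsort D' O' :=
  match s with
  | inl r => inl (mrs m r)
  | inr (o, f) => at_ (g o) (msrt m (inr f))
  end.

Definition tr_sort_at (o : O) (s : srt D) :
    tr_sort (at_ o s) = at_ (g o) (msrt m s) :=
  match s with
  | inl r => congr1 (@at_ D' O' (g o)) (esym (msrtE m r))
  | inr f => erefl
  end.

Definition app_funsym (o : O') n (a : 'I_n -> srt D') s (f : funsym a s) :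
    (forall i, @term D' O' (at_ o (a i))) -> @term D' O' (at_ o s) :=
  match f in @funsym _ n a s
    return (forall i, @term D' O' (at_ o (a i))) -> @term D' O' (at_ o s) with
  | FunsymC a s r c es => fun _ =>
      eq_rect_r (fun s => @term D' O' (at_ o s))
        (TCst O' c : @term D' O' (at_ o (inl r))) es
  | FunsymR n a s b r f ea es => fun ts =>
      eq_rect_r (fun s => @term D' O' (at_ o s))
        (TRig f (fun i =>
           eq_rect _ (fun s => @term D' O' (at_ o s)) (ts i) _ (ea i))
         : @term D' O' (at_ o (inl r))) es
  | FunsymF n a s f => fun ts => TFlex f ts
  end.

Fixpoint tr_term (s : tsort D O) (t : term s) : @term D' O' (tr_sort s) :=
  match t in term s return @term D' O' (tr_sort s) with
  | TCst s c => rc c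
  | TRig n a s f ts => TRig (mrfun m f) (fun i => tr_term (ts i))
  | TFlex o n a s f ts =>
      eq_rect_r (@term D' O')
        (app_funsym (mflfun m f) (fun i =>
           eq_rect _ (@term D' O') (tr_term (ts i)) _ (tr_sort_at o (a i))))
        (tr_sort_at o s)
  end.

End TermTranslation.

Definition rterm_hterm (D : signature) (s : rsort D) (t : rterm s) :
    @hterm D (inl s) :=
  tr_term (m := id_pre D) Some (fun s c => TCst (htag D) c) t.

Definition rterm_incl (D : signature) (C : esort D -> Type)
    (s : rsort D) (t : rterm s) : @rterm (ext C) s :=
  tr_term (m := ext_incl_pre C) inl
    (fun s c => TCst (D := ext C) (nom (ext C)) (inl c)) t.

(** * Actions and sentences *)

Inductive action (L : Type) : Type :=
| AMod of L
| ASeq of action L & action L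
| ACup of action L & action L
| AStar of action L.

Fixpoint map_action (L L' : Type) (h : L -> L') (a : action L) : action L' :=
  match a with
  | AMod l => AMod (h l)
  | ASeq a b => ASeq (map_action h a) (map_action h b)
  | ACup a b => ACup (map_action h a) (map_action h b)
  | AStar a => AStar (map_action h a)
  end.

(** Bound variables are nameless: [Store] and [Ex] bind the new symbols of the
    extended signature. *)
Inductive sen (D : signature) : Type :=
| Nom of nom D
| Eq (s : tsort D (htag D)) of hterm s & hterm s
| Rrel n (a : 'I_n -> rsort D) of rrel a & (forall i, @hterm D (inl (a i)))
| Frel (o : htag D) n (a : 'I_n -> srt D) of
    flrel a & (forall i, @hterm D (at_ o (a i)))
| At of nom D & sen D
| Neg of sen D
| Or n of ('I_n -> sen D)
| Store of sen (ext (@znom D))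
| Ex n (X : 'I_n -> esort D) of sen (ext (fam X))
| Dia of action (modal D) & sen D.

(** [Dia_iter n a phi] is [<a^n> phi], where [a^(n+1) = a; a^n], [a^1 = a] and
    [<a^0> phi] is [phi]. *)
Definition Dia_iter (D : signature) (n : nat) (a : action (modal D))
    (phi : sen D) : sen D :=
  let fix pow n := if n is n'.+1 then ASeq a (pow n') else a in
  if n is n'.+1 then Dia (pow n') phi else phi.

(** * Translations

    A translation acts as a morphism, except that rigid constants may be sent
    to rigid terms.  Signature morphisms and substitutions both induce
    translations. *)

Record trans (D D' : signature) := Trans {
  tr_pre :> premor D D';
  tr_cst : forall s, rcst D s -> @rterm D' (mrs tr_pre s)
}.

Definition trans_mor (D D' : signature) (m : morphism D D') : trans D D' :=
  @Trans D D' m (fun _ c => TCst (nom D') (mor_cst m c)).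

Record subst (D : signature) (C1 C2 : esort D -> Type) := Subst {
  sub_nom : C1 None -> nom (ext C2);
  sub_cst : forall s, C1 (Some s) -> @rterm (ext C2) s
}.

Definition trans_subst (D : signature) (C1 C2 : esort D -> Type)
    (th : subst C1 C2) : trans (ext C1) (ext C2) :=
  @Trans (ext C1) (ext C2)
    (@Premor (ext C1) (ext C2)
      (fun k => match k with inl k => inl k | inr c => sub_nom th c end)
      id id id (fun _ => erefl)
      (fun _ _ _ f => f) (fun _ _ p => p)
      (fun _ _ _ f => @FunsymF (ext C2) _ _ _ f)
      (fun _ _ p => @RelsymF (ext C2) _ _ p))
    (fun s c => match c with
      | inl c => TCst (D := ext C2) (nom (ext C2)) (inl c)
      | inr c => sub_cst th c
      end).

Section Lift.
Variables (D D' : signature) (m : trans D D').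
Variables (C : esort D -> Type) (C' : esort D' -> Type).
Variable h : forall s, C s -> C' (omap (mrs m) s).

Definition tr_lift : trans (ext C) (ext C') :=
  @Trans (ext C) (ext C')
    (@Premor (ext C) (ext C')
      (fun k => match k with
        | inl k => inl (mnom m k)
        | inr c => inr (@h None c)
        end)
      (mmod m) (mrs m) (msrt m) (msrtE m)
      (fun _ _ _ f => mrfun m f) (fun _ _ p => mrrel m p)
      (fun _ _ _ f => funsym_map (ext_incl C') (mflfun m f))
      (fun _ _ p => relsym_map (ext_incl_pre C') (mflrel m p)))
    (fun s c => match c with
      | inl c => rterm_incl C' (tr_cst m c)
      | inr c => TCst (D := ext C') (nom (ext C')) (inr (@h (Some s) c))
      end).

End Lift.

Definition tr_lift_znom (D D' : signature) (m : trans D D') :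
    trans (ext (@znom D)) (ext (@znom D')) :=
  tr_lift (m := m) (C' := @znom D')
    (fun s => match s return znom s -> znom (omap (mrs m) s) with
      | Some _ => id
      | None => id
      end).

Definition tr_lift_fam (D D' : signature) (m : trans D D')
    n (X : 'I_n -> esort D) :
    trans (ext (fam X)) (ext (fam (fun i => omap (mrs m) (X i)))) :=
  tr_lift (m := m) (C' := fam (fun i => omap (mrs m) (X i)))
    (fun s x => match x in fam _ s
        return fam (fun i => omap (mrs m) (X i)) (omap (mrs m) s) with
      | Var i => Var (fun i => omap (mrs m) (X i)) i
      end).

Definition tr_hterm (D D' : signature) (m : trans D D') s (t : @hterm D s) :
    @hterm D' (tr_sort m (omap (mnom m)) s) :=
  tr_term (m := m) (omap (mnom m)) (fun _ c => rterm_hterm (tr_cst m c)) t.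

Definition app_relsym (D : signature) (o : htag D) n (a : 'I_n -> srt D)
    (p : relsym a) : (forall i, @hterm D (at_ o (a i))) -> sen D :=
  match p in @relsym _ n a
    return (forall i, @hterm D (at_ o (a i))) -> sen D with
  | RelsymR n a b p ea => fun ts =>
      Rrel p (fun i =>
        eq_rect _ (fun s => @hterm D (at_ o s)) (ts i) _ (ea i))
  | RelsymF n a p => fun ts => Frel p ts
  end.

Fixpoint tr_sen (D : signature) (phi : sen D) :
    forall D', trans D D' -> sen D' :=
  match phi with
  | Nom k => fun D' m => Nom (mnom m k)
  | Eq s t1 t2 => fun D' m => Eq (tr_hterm m t1) (tr_hterm m t2)
  | Rrel n a p ts => fun D' m =>
      Rrel (mrrel m p) (fun i => tr_hterm m (ts i))
  | Frel o n a p ts => fun D' m =>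
      app_relsym (o := omap (mnom m) o) (mflrel m p) (fun i =>
        eq_rect _ (@hterm D') (tr_hterm m (ts i)) _
          (tr_sort_at m (omap (mnom m)) o (a i)))
  | At k phi => fun D' m => At (mnom m k) (tr_sen phi m)
  | Neg phi => fun D' m => Neg (tr_sen phi m)
  | Or n Phi => fun D' m => Or (fun i => tr_sen (Phi i) m)
  | Store phi => fun D' m => Store (tr_sen phi (tr_lift_znom m))
  | Ex n X phi => fun D' m => Ex (tr_sen phi (tr_lift_fam m X))
  | Dia a phi => fun D' m => Dia (map_action (mmod m) a) (tr_sen phi m)
  end.

Definition mor_sen (D D' : signature) (m : morphism D D') (phi : sen D) :
    sen D' := tr_sen phi (trans_mor m).

Definition subst_sen (D : signature) (C1 C2 : esort D -> Type)
    (th : subst C1 C2) (phi : sen (ext C1)) : sen (ext C2) :=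
  tr_sen phi (trans_subst th).

(** * Kripke structures *)

Definition carrier (R F : Type) (rc : R -> Type) (fc : F -> Type)
    (s : R + F) : Type :=
  match s with inl r => rc r | inr f => fc f end.

(** The rigid symbols are interpreted once and for all, the flexible ones in
    each world. *)
Record kripke (D : signature) := Kripke {
  world : Type;
  world_inh : inhabited world;
  nomI : nom D -> world;
  modalI : modal D -> world -> world -> Prop;
  rcar : rsort D -> Type;
  rcar_inh : forall s, inhabited (rcar s);
  rcstI : forall s, rcst D s -> rcar s;
  rfunI : forall n (a : 'I_n.+1 -> rsort D) s, rfun a s ->
    (forall i, rcar (a i)) -> rcar s;
  rrelI : forall n (a : 'I_n -> rsort D), rrel a ->
    (forall i, rcar (a i)) -> Prop;
  flcar : world -> flsort D -> Type;
  flcar_inh : forall w s, inhabited (flcar w s);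
  flfunI : forall w n (a : 'I_n -> srt D) s, flfun a s ->
    (forall i, carrier rcar (flcar w) (a i)) -> carrier rcar (flcar w) s;
  flrelI : forall w n (a : 'I_n -> srt D), flrel a ->
    (forall i, carrier rcar (flcar w) (a i)) -> Prop
}.

Definition car (D : signature) (K : kripke D) (w : world K) : srt D -> Type :=
  carrier (@rcar D K) (flcar w).

Definition dom (D : signature) (K : kripke D) (s : esort D) : Type :=
  if s is Some r then rcar K r else world K.

(** The expansion of [K] to [ext C] that interprets the new constants
    by [v]. *)
Definition expand (D : signature) (K : kripke D) (C : esort D -> Type)
    (v : forall s, C s -> dom K s) : kripke (ext C) :=
  @Kripke (ext C) (world K) (world_inh K)
    (fun k => match k with inl k => nomI K k | inr c => v None c end)
    (@modalI D K) (@rcar D K) (@rcar_inh D K)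
    (fun s c => match c with inl c => rcstI K c | inr c => v (Some s) c end)
    (@rfunI D K) (@rrelI D K) (@flcar D K) (@flcar_inh D K)
    (@flfunI D K) (@flrelI D K).

Section Evaluation.
Variables (D : signature) (K : kripke D) (O : Type) (wd : O -> world K).

Definition tcar (s : tsort D O) : Type :=
  match s with inl r => rcar K r | inr (o, f) => flcar (wd o) f end.

Definition to_tcar (o : O) (s : srt D) : car (wd o) s -> tcar (at_ o s) :=
  match s with inl r => id | inr f => id end.

Definition of_tcar (o : O) (s : srt D) : tcar (at_ o s) -> car (wd o) s :=
  match s with inl r => id | inr f => id end.

Fixpoint eval (s : tsort D O) (t : term s) : tcar s :=
  match t in term s return tcar s with
  | TCst s c => rcstI K c
  | TRig n a s f ts => rfunI f (fun i => eval (ts i))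
  | TFlex o n a s f ts =>
      to_tcar (flfunI f (fun i => of_tcar (eval (ts i))))
  end.

End Evaluation.

Definition tag_world (D : signature) (K : kripke D) (w : world K)
    (o : htag D) : world K :=
  if o is Some k then nomI K k else w.

Definition heval (D : signature) (K : kripke D) (w : world K)
    s (t : @hterm D s) : tcar (tag_world w) s := eval (tag_world w) t.

Fixpoint action_rel (D : signature) (K : kripke D) (a : action (modal D)) :
    world K -> world K -> Prop :=
  match a with
  | AMod l => @modalI D K l
  | ASeq a b => fun w w' =>
      exists2 u, action_rel a w u & action_rel b u w'
  | ACup a b => fun w w' => action_rel a w w' \/ action_rel b w w'
  | AStar a => clos_refl_trans (world K) (@action_rel D K a)
  end.

Definition znom_val (D : signature) (K : kripke D) (w : world K)
    (s : esort D) : znom s -> dom K s :=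
  match s return znom s -> dom K s with
  | Some r => fun e => match e with end
  | None => fun _ => w
  end.

Fixpoint sat (D : signature) (phi : sen D) :
    forall K : kripke D, world K -> Prop :=
  match phi with
  | Nom k => fun K w => nomI K k = w
  | Eq s t1 t2 => fun K w => heval w t1 = heval w t2
  | Rrel n a p ts => fun K w => rrelI p (fun i => heval w (ts i))
  | Frel o n a p ts => fun K w =>
      flrelI p (fun i => of_tcar (heval w (ts i)))
  | At k phi => fun K w => sat phi (nomI K k)
  | Neg phi => fun K w => ~ sat phi w
  | Or n Phi => fun K w => exists i, sat (Phi i) w
  | Store phi => fun K w => @sat _ phi (expand (@znom_val D K w)) w
  | Ex n X phi => fun K w =>
      exists v : forall s, fam X s -> dom K s, @sat _ phi (expand v) w
  | Dia a phi => fun K w => exists2 w', action_rel a w w' & sat phi w'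
  end.

Definition gsat (D : signature) (K : kripke D) (phi : sen D) : Prop :=
  forall w : world K, sat phi w.

Definition models (D : signature) (K : kripke D) (T : set (sen D)) : Prop :=
  forall phi, T phi -> gsat K phi.

Definition satisfiable (D : signature) (T : set (sen D)) : Prop :=
  exists K : kripke D, models K T.

Definition entails (D : signature) (T G : set (sen D)) : Prop :=
  forall K : kripke D, models K T -> models K G.

(** * Fragments *)

Record fragment := Fragment {
  fsig : signature -> Prop;
  fmor : forall D D', morphism D D' -> Prop;
  fsen : forall D, set (sen D);
  fmor_dom : forall D D' (m : morphism D D'), fmor m -> fsig D;
  fmor_cod : forall D D' (m : morphism D D'), fmor m -> fsig D';
  fmor_id : forall D, fsig D -> fmor (id_mor D);
  fmor_comp : forall D D' D'' (m : morphism D D') (m' : morphism D' D''),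
    fmor m -> fmor m' -> fmor (comp_mor m' m);
  fsen_mor : forall D D' (m : morphism D D'), fmor m ->
    forall phi, fsen phi -> fsen (mor_sen m phi);
  fmor_incl : forall D, fsig D ->
    forall C : esort D -> Type, fmor (ext_incl C);
  fsen_subst : forall D, fsig D ->
    forall (C1 C2 : esort D -> Type) (th : subst C1 C2) phi,
    fsen phi -> fsen (subst_sen th phi);
  fsen_seq : forall D, fsig D -> forall a b (phi : sen D),
    fsen (Dia (ASeq a b) phi) -> fsen (Dia a phi) /\ fsen (Dia b phi);
  fsen_cup : forall D, fsig D -> forall a b (phi : sen D),
    fsen (Dia (ACup a b) phi) -> fsen (Dia a phi) /\ fsen (Dia b phi);
  fsen_star : forall D, fsig D -> forall a (phi : sen D),
    fsen (Dia (AStar a) phi) -> exists n, fsen (Dia_iter n a phi);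
  fsen_dia : forall D, fsig D -> forall a (phi : sen D),
    fsen (Dia a phi) -> fsen phi;
  fsen_neg : forall D, fsig D -> forall phi : sen D,
    fsen (Neg phi) -> fsen phi;
  fsen_at : forall D, fsig D -> forall k (phi : sen D),
    fsen (At k phi) -> fsen phi;
  fsen_or : forall D, fsig D -> forall n (Phi : 'I_n -> sen D),
    fsen (Or Phi) -> forall i, fsen (Phi i);
  fsen_store : forall D, fsig D -> forall phi : sen (ext (@znom D)),
    fsen (Store phi) -> fsen phi;
  fsen_ex : forall D, fsig D ->
    forall n (X : 'I_n -> esort D) (phi : sen (ext (fam X))),
    fsen (Ex phi) -> fsen phi
}.

Section SemanticClosure.
Variable L : fragment.

(** Some sentence of the fragment is satisfied at the same worlds of the same
    Kripke structures as [phi]. *)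
Definition expressible (D : signature) (phi : sen D) : Prop :=
  exists2 psi, fsen L psi &
    forall (K : kripke D) (w : world K), sat psi w <-> sat phi w.

Definition closed_equality : Prop :=
  forall D, fsig L D ->
    (forall k : nom D, expressible (Nom k)) /\
    (forall s (t1 t2 : @hterm D s), expressible (Eq t1 t2)).

Definition closed_retrieve : Prop :=
  forall D, fsig L D -> forall (k : nom D) (phi : sen D),
    fsen L phi -> expressible (At k phi).

Definition closed_negation : Prop :=
  forall D, fsig L D -> forall phi : sen D,
    fsen L phi -> expressible (Neg phi).

Definition closed_disjunction : Prop :=
  forall D, fsig L D -> forall n (Phi : 'I_n -> sen D),
    (forall i, fsen L (Phi i)) -> expressible (Or Phi).

Definition closed_possibility : Prop :=
  forall D, fsig L D -> forall (l : modal D) (phi : sen D),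
    fsen L phi -> expressible (Dia (AMod l) phi).

Definition closed_quantifiers : Prop :=
  forall D, fsig L D ->
    forall n (X : 'I_n -> esort D) (phi : sen (ext (fam X))),
    fsen L phi -> expressible (Ex phi).

End SemanticClosure.

(** * Cardinals *)

(** A cardinal is an initial ordinal, presented as a well-ordered type. *)
Record cardinal := Cardinal {
  ordT :> Type;
  olt : ordT -> ordT -> Prop;
  olt_trans : forall a b c, olt a b -> olt b c -> olt a c;
  olt_total : forall a b, olt a b \/ a = b \/ olt b a;
  olt_wf : well_founded olt;
  olt_initial : forall a, ~ ([set: ordT] #<= [set b | olt b a])
}.

Definition ole (A : cardinal) (a b : A) : Prop := olt a b \/ a = b.

Definition card_lt (T : Type) (X : set T) (A : cardinal) : Prop :=
  X #<= [set: A] /\ ~ ([set: A] #<= X).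

Definition linear_order (T : Type) (le : T -> T -> Prop) : Prop :=
  [/\ forall x, le x x,
      forall x y, le x y -> le y x -> x = y,
      forall x y z, le x y -> le y z -> le x z
    & forall x y, le x y \/ le y x].

Definition cofinal (T : Type) (le : T -> T -> Prop) (X : set T) : Prop :=
  forall x, exists2 y, X y & le x y.

Definition has_cofinality (T : Type) (le : T -> T -> Prop) (A : cardinal) :
    Prop :=
  (exists2 X, cofinal le X & X #= [set: A]) /\
  (forall X, cofinal le X -> [set: A] #<= X).

Definition infinite_card (A : cardinal) : Prop := infinite_set [set: A].

Definition regular (A : cardinal) : Prop :=
  infinite_card A /\ has_cofinality (@ole A) A.

(** The power of [D], the maximum of omega and the number of symbols of [D],
    is at most [A]. *)
Definition power_le (D : signature) (A : cardinal) : Prop :=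
  [set: nat] #<= [set: A] /\ [set: symbol D] #<= [set: A].

(** * Omitting types *)

Definition realizes (D : signature) (K : kripke D) (X : esort D -> Type)
    (G : set (sen (ext X))) : Prop :=
  exists v : forall s, X s -> dom K s, models (expand v) G.

Definition omits (D : signature) (K : kripke D) (X : esort D -> Type)
    (G : set (sen (ext X))) : Prop := ~ realizes K G.

Definition card_realizes (L : fragment) (A : cardinal) (D : signature)
    (T : set (sen D)) (X : esort D -> Type) (G : set (sen (ext X))) : Prop :=
  exists (C : esort D -> Type) (th : subst X C) (p : set (sen (ext C))),
    [/\ forall s, card_lt [set: C s] A,
        p `<=` @fsen L (ext C),
        card_lt p A,
        satisfiable (mor_sen (ext_incl C) @` T `|` p)
      & entails (mor_sen (ext_incl C) @` T `|` p) (subst_sen th @` G)].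

Definition card_omits (L : fragment) (A : cardinal) (D : signature)
    (T : set (sen D)) (X : esort D -> Type) (G : set (sen (ext X))) : Prop :=
  ~ card_realizes L A T G.

Definition omitting_types_property (L : fragment) (A : cardinal) : Prop :=
  forall D, fsig L D -> power_le D A ->
  forall T : set (sen D), T `<=` @fsen L D -> satisfiable T ->
  forall (X : A -> esort D -> Type) (G : forall i : A, set (sen (ext (X i)))),
    (forall i s, finite_set [set: X i s]) ->
    (forall i, G i `<=` @fsen L (ext (X i))) ->
    (forall i, card_omits L A T (G i)) ->
  exists K : kripke D, models K T /\ forall i, omits K (G i).

(** * Adding a binary relation on some of the sorts *)

Inductive order_rel (D : signature) (I : set (esort D)) :
    forall n, ('I_n -> rsort D) -> Type :=
| OrderRel (s : rsort D) of I (Some s) : order_rel I (fun _ : 'I_2 => s).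

(** A new modality if [I None] holds, and a new rigid binary relation on [s]
    if [I (Some s)] holds. *)
Definition add_order (D : signature) (I : set (esort D)) : signature :=
  {| nom := nom D;
     modal := (modal D + I None)%type;
     rsort := rsort D;
     rcst := rcst D;
     rfun := @rfun D;
     rrel := fun n a => (@rrel D n a + @order_rel D I n a)%type;
     flsort := flsort D;
     flfun := @flfun D;
     flrel := @flrel D |}.

Definition order_reduct (D : signature) (I : set (esort D))
    (K : kripke (add_order I)) : kripke D :=
  @Kripke D (world K) (world_inh K) (@nomI _ K)
    (fun l => modalI (k := K) (inl l))
    (@rcar _ K) (@rcar_inh _ K) (@rcstI _ K) (@rfunI _ K)
    (fun n a p => rrelI (k := K) (inl p))
    (@flcar _ K) (@flcar_inh _ K) (@flfunI _ K) (@flrelI _ K).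

Definition pair2 (T : Type) (x y : T) (i : 'I_2) : T :=
  if val i is 0 then x else y.

(** The interpretation in [K] of the added relation on the sort [s]. *)
Definition orderI (D : signature) (I : set (esort D))
    (K : kripke (add_order I)) (s : esort D) :
    I s -> @dom (add_order I) K s -> @dom (add_order I) K s -> Prop :=
  match s return
    I s -> @dom (add_order I) K s -> @dom (add_order I) K s -> Prop with
  | Some r => fun h x y =>
      rrelI (k := K) (a := fun _ : 'I_2 => r) (inr (OrderRel h)) (pair2 x y)
  | None => fun h => modalI (k := K) (inr h)
  end.

Definition infinite_sorts (D : signature) (K : kripke D) : set (esort D) :=
  [set s | infinite_set [set: dom K s]].

(* Main.v *)
Require Import Defs.
From mathcomp Require Import all_boot.
From mathcomp Require Import boolp classical_sets functions cardinality.
From mathcomp Require Import wochoice.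
From Stdlib Require Import Relation_Operators Wellfounded.

(** A set with at least [A] elements carries a linear order of cofinality [A]:
    put a copy of [A] on top of a linear order of the other elements.  So it is
    enough to find a model of [T] with large sorts.

    If [A] is countable, [K] will do.  Otherwise add to each sort [s] that is infinite in [K] distinct
    constants [e_n] for [n] in omega, and constants [c_j] for [j] in [A] that
    are equal to [e_0] or different from all the other [c_k].  A model omitting
    all the types saying that [c_j = e_0] for all [j > i] is as required.  If
    these types are not all omitted by the theory, then the theory, together
    with fewer than [A] sentences [p], implies one of them.  The elements of
    the sort concerned are then all named by the constants [e_n] and [c_j],
    since an unnamed one could be the value of some [c_j] not occurring in [p].

    A sort all of whose elements are named can be used to express, by
    first-order sentences in still more constants, that a subset of [A] has no
    limit point of cofinality omega.  The types saying that this subset is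
    bounded in [A] are omitted by the theory, but have no common omitting
    model, because an unbounded subset of [A] does have such a limit point. *)

Set Implicit Arguments.
Unset Strict Implicit.
Unset Printing Implicit Defensive.

Local Open Scope classical_set_scope.
Local Open Scope card_scope.

(** * Translations that change only constants *)

Definition cst (D : signature) (s : esort D) : Type :=
  if s is Some r then rcst D r else nom D.

Definition cval (D : signature) (K : kripke D) (s : esort D) :
    cst s -> dom K s :=
  match s return cst s -> dom K s with
  | Some r => @rcstI D K r
  | None => @nomI D K
  end.

(** Inclusions into extensions, substitutions, and the liftings of both under
    binders are, up to conversion, all of the form [reconst_trans] below. *)
Section Reconst.
Variables (D : signature) (N : Type) (C : rsort D -> Type).

Definition reconst : signature :=
  {| nom := N; modal := modal D; rsort := rsort D; rcst := C;
     rfun := @rfun D; rrel := @rrel D; flsort := flsort D;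
     flfun := @flfun D; flrel := @flrel D |}.

Definition reconst_pre (fn : nom D -> N) : premor D reconst :=
  @Premor D reconst fn id id id (fun _ => erefl)
    (fun _ _ _ f => f) (fun _ _ p => p)
    (fun _ _ _ f => @FunsymF reconst _ _ _ f)
    (fun _ _ p => @RelsymF reconst _ _ p).

Definition reconst_trans (fn : nom D -> N)
    (fc : forall s, rcst D s -> @rterm reconst s) : trans D reconst :=
  @Trans D reconst (reconst_pre fn) fc.

(** [v] need not come from a translation, so it may disagree with one on the constants that do not
    occur in a given sentence. *)
Definition revalue (K : kripke reconst)
    (v : forall s : esort D, cst s -> @dom reconst K s) : kripke D :=
  @Kripke D (world K) (world_inh K) (v None) (@modalI _ K) (@rcar _ K)
    (@rcar_inh _ K) (fun s => v (Some s)) (@rfunI _ K) (@rrelI _ K)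
    (@flcar _ K) (@flcar_inh _ K) (@flfunI _ K) (@flrelI _ K).

(** Rigid carriers do not depend on the world. Flexible ones do, and the worlds named by a nominal
    and by its translation are only propositionally equal, whence the transport. *)
Definition same_at (K : kripke reconst) v (w w' : world K) (s : srt D) :
    car (K := revalue (K := K) v) w s -> car (K := K) w' s -> Prop :=
  match s return car (K := revalue (K := K) v) w s ->
      car (K := K) w' s -> Prop with
  | inl r => fun x y => x = y
  | inr f => fun x y => exists e : w = w',
      eq_rect _ (fun w => flcar w f) x _ e = y
  end.

Lemma same_at_eq (K : kripke reconst) v (w : world K) n (a : 'I_n -> srt D)
    (x : forall i, car (K := revalue (K := K) v) w (a i))
    (y : forall i, car (K := K) w (a i)) :
  (forall i, same_at (x i) (y i)) -> x = y.
Proof.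
move=> hxy; apply: functional_extensionality_dep => i; move: (hxy i).
case: (a i) (x i) (y i) => //= u xi yi [e].
by rewrite (Prop_irrelevance e erefl).
Qed.

Lemma same_at_rel (K : kripke reconst) v (w w' : world K) n
    (a : 'I_n -> srt D) (p : flrel a)
    (x : forall i, car (K := revalue (K := K) v) w (a i))
    (y : forall i, car (K := K) w' (a i)) :
  w = w' -> (forall i, same_at (x i) (y i)) ->
  flrelI (k := revalue (K := K) v) p x <-> flrelI (k := K) p y.
Proof. by move=> e; subst w' => /same_at_eq ->. Qed.

Section Terms.
Variables (O O' : Type) (g : O -> O').

Definition same_car (fn : nom D -> N) (K : kripke reconst) v
    (wd : O -> world K) (wd' : O' -> world K) (s : tsort D O) :
    tcar (K := revalue (K := K) v) wd s ->
    tcar wd' (tr_sort (reconst_pre fn) g s) -> Prop :=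
  match s return tcar (K := revalue (K := K) v) wd s ->
      tcar wd' (tr_sort (reconst_pre fn) g s) -> Prop with
  | inl r => fun x y => x = y
  | inr (o, f) => fun x y => exists e : wd o = wd' (g o),
      eq_rect _ (fun w => flcar w f) x _ e = y
  end.

Lemma same_car_of (fn : nom D -> N) (K : kripke reconst) v
    (wd : O -> world K) (wd' : O' -> world K) (o : O) (s : srt D) x
    (t : term (tr_sort (reconst_pre fn) g (at_ o s))) :
  same_car (fn := fn) (v := v) (wd := wd) (s := at_ o s) x (eval wd' t) ->
  same_at (of_tcar (K := revalue (K := K) v) (wd := wd) (o := o) x)
    (of_tcar (eval wd' (eq_rect _ (@term reconst O') t _
       (tr_sort_at (reconst_pre fn) g o s)))).
Proof. by case: s x t. Qed.

End Terms.

Definition trans_val (K : kripke reconst) (fn : nom D -> N)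
    (fc : forall s, rcst D s -> @rterm reconst s) (s : esort D) :
    cst s -> @dom reconst K s :=
  match s return cst s -> @dom reconst K s with
  | Some r => fun c => eval (@nomI _ K) (fc r c)
  | None => fun k => nomI K (fn k)
  end.

Definition agree (K : kripke reconst) (fn : nom D -> N)
    (fc : forall s, rcst D s -> @rterm reconst s)
    (v : forall s : esort D, cst s -> @dom reconst K s)
    (F : set {s : esort D & cst s}) : Prop :=
  forall s (c : cst s), F (existT _ s c) -> v s c = trans_val K fn fc c.

End Reconst.

(** Arities are finite, so a term involves finitely many constants [F] and tags [FO]. These are
    found before the translation and the structure are given, and serve for all of them. *)
Lemma eval_tr_term (D : signature) (O : Type) (s : tsort D O) (t : term s) :
  exists (F : set {s : rsort D & rcst D s}) (FO : set O),
  [/\ finite_set F, finite_set FO &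
   forall N C (fn : nom D -> N) (O' : Type) (g : O -> O')
     (rc : forall s, rcst D s -> @term (reconst N C) O' (inl s))
     (K : kripke (reconst N C)) v (wd : O -> world K) (wd' : O' -> world K),
   (forall o, FO o -> wd o = wd' (g o)) ->
   (forall s (c : rcst D s), F (existT _ s c) ->
      v (Some s) c = eval wd' (rc s c)) ->
   same_car (fn := fn) (v := v) (eval (K := revalue (K := K) v) wd t)
     (eval wd' (tr_term (m := reconst_pre C fn) g rc t))].
Proof.
elim: s / t => [s c|n a s f ts IH|o n a s f ts IH].
- exists [set existT _ s c], set0; split => //.
  by move=> N C fn O' g rc K v wd wd' _ /(_ s c erefl).
- have [F /choice[FO H]] := choice IH.
  exists (\bigcup_i F i), (\bigcup_i FO i); split.
  + by apply: bigcup_finite => // i _; case: (H i).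
  + by apply: bigcup_finite => // i _; case: (H i).
  + move=> N C fn O' g rc K v wd wd' hO hF /=.
    congr (rfunI _ _); apply: functional_extensionality_dep => i.
    case: (H i) => _ _; apply.
    * by move=> o oF; apply: hO; exists i.
    * by move=> s' c cF; apply: hF; exists i.
- have [F /choice[FO H]] := choice IH.
  exists (\bigcup_i F i), (o |` \bigcup_i FO i); split.
  + by apply: bigcup_finite => // i _; case: (H i).
  + rewrite finite_setU; split => //.
    by apply: bigcup_finite => // i _; case: (H i).
  + move=> N C fn O' g rc K v wd wd' hO hF /=.
    have e : wd o = wd' (g o) by apply: hO; left.
    have {}H i : same_car (fn := fn) (v := v)
        (eval (K := revalue (K := K) v) wd (ts i))
        (eval wd' (tr_term (m := reconst_pre C fn) g rc (ts i))).
      case: (H i) => _ _; apply.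
      * by move=> o' o'F; apply: hO; right; exists i.
      * by move=> s' c cF; apply: hF; exists i.
    (* Stated for arbitrary worlds, so that their equality can be eliminated by substitution. *)
    have same_funI (w w' : world K) x y : w = w' ->
        (forall i, same_at (v := v) (w := w) (w' := w') (x i) (y i)) ->
        same_at (v := v) (w := w) (w' := w') (s := s)
          (flfunI (k := revalue (K := K) v) f x) (flfunI (k := K) f y).
      move=> ew; subst w' => hxy.
      by rewrite (same_at_eq hxy); case: s f => //= u f; exists erefl.
    have to_at (u : srt D) x (t : @term (reconst N C) O' (@at_ (reconst N C) O' (g o) u)) :
        same_at (v := v) x (of_tcar (eval wd' t)) ->
        same_car (fn := fn) (v := v) (s := at_ o u)
          (to_tcar (K := revalue (K := K) v) (wd := wd) (o := o) x)
          (eval wd' (eq_rect_r (@term (reconst N C) O') t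
             (tr_sort_at (reconst_pre C fn) g o u))).
      by case: u x t.
    apply: to_at => /=.
    have to_tcarK u z : of_tcar (to_tcar (K := K) (wd := wd') (o := g o) (s := u) z) = z.
      by case: u z.
    by rewrite to_tcarK; apply: same_funI => // i; exact: same_car_of.
Qed.

Lemma eval_rterm_incl (D : signature) N (C0 : rsort D -> Type)
    (C : esort D -> Type) (K : kripke (reconst N C0))
    (v : forall s, C s -> @dom (reconst N C0) K s) s
    (t : @rterm (reconst N C0) s) :
  eval (@nomI _ (@expand (reconst N C0) K C v)) (@rterm_incl (reconst N C0) C s t) =
  eval (@nomI _ K) t.
Proof.
(* With [K] in constructor form, [revalue] of its expansion at its own constants is convertible to
   [K]. *)
case: K v => W Wi nI mI rc rci cI fI rI fc fci ffI fri v.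
have [F [FO [_ _ H]]] := eval_tr_term t.
pose K := Kripke Wi nI mI rci cI fI rI fci ffI fri.
apply/esym; exact: (H _ _ inl _ inl _ (@expand (reconst N C0) _ C v) (@cval _ K) nI
  (fun k => match k with inl k => nI k | inr c => v None c end)).
Qed.

Lemma eval_rterm_hterm (D : signature) N (C0 : rsort D -> Type)
    (K : kripke (reconst N C0)) w s (t : @rterm (reconst N C0) s) :
  @heval (reconst N C0) K w _ (rterm_hterm t) = eval (@nomI _ K) t.
Proof.
case: K w => W Wi nI mI rc rci cI fI rI fc fci ffI fri w.
have [F [FO [_ _ H]]] := eval_tr_term t.
pose K := Kripke Wi nI mI rci cI fI rI fci ffI fri.
apply/esym; exact: (H _ _ id _ Some _ K (@cval _ K) nI (@tag_world _ K w)).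
Qed.

Lemma heval_tr_hterm (D : signature) s (t : @hterm D s) :
  exists2 F : set {s : esort D & cst s}, finite_set F &
  forall N C fn fc (K : kripke (@reconst D N C)) v,
  @agree D N C K fn fc v F -> forall w : world K,
  same_car (fn := fn) (v := v) (wd := tag_world (K := revalue (K := K) v) w)
    (heval (K := revalue (K := K) v) w t)
    (heval w (tr_hterm (reconst_trans fn fc) t)).
Proof.
have [F [FO [finF finFO H]]] : exists (F : set {s : rsort D & rcst D s})
    (FO : set (htag D)), [/\ finite_set F, finite_set FO &
    forall N C fn fc (K : kripke (@reconst D N C)) v (w : world K),
    (forall o, FO o -> tag_world (K := revalue (K := K) v) w o =
       tag_world (K := K) w (omap fn o)) ->
    (forall s (c : rcst D s), F (existT _ s c) ->
      v (Some s) c = trans_val (s := Some s) K fn fc c) ->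
    same_car (fn := fn) (v := v) (wd := tag_world (K := revalue (K := K) v) w)
      (heval (K := revalue (K := K) v) w t)
      (heval w (tr_hterm (reconst_trans fn fc) t))].
  have [F [FO [finF finFO H]]] := eval_tr_term t.
  exists F, FO; split => // N C fn fc K v w hO hF.
  apply: (H N C fn _ (omap fn) (fun _ c => rterm_hterm (fc _ c)) K v) => //.
  by move=> r c cF; rewrite hF //; apply/esym; exact: eval_rterm_hterm.
(* The rigid constants that occur, and the nominals that occur as tags; the tag [None] is the
   current world on both sides. *)
exists ((fun x => existT _ (Some (projT1 x)) (projT2 x)) @` F `|`
   (fun k => existT (@cst D) None k) @` (Some @^-1` FO)).
- rewrite finite_setU; split; apply: finite_image => //.
  by apply: finite_preimage => // x y _ _ [].
- move=> N C fn fc K v hF w; apply: H.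
    case=> //= k kF; apply: (hF None); right; by exists k.
  by move=> r c cF; apply: hF; left; exists (existT _ r c).
Qed.

Lemma action_rel_revalue (D : signature) N C (K : kripke (@reconst D N C)) v
    (a : action (modal D)) (w w' : world K) :
  action_rel (K := K) (map_action id a) w w' <->
  action_rel (K := revalue (K := K) v) a w w'.
Proof.
have -> : map_action id a = a.
  by elim: a {w w'} => //= [a -> b ->|a -> b ->|a ->].
suff -> : @action_rel (reconst N C) K a = @action_rel D (revalue (K := K) v) a by [].
by elim: a {w w'} => //= [a -> b ->|a -> b ->|a ->].
Qed.

Lemma same_car_inj (D : signature) N C O O' (g : O -> O') (fn : nom D -> N)
    (K : kripke (@reconst D N C)) v (wd : O -> world K) (wd' : O' -> world K)
    (s : tsort D O)
    (x1 x2 : tcar (K := revalue (K := K) v) wd s)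
    (y1 y2 : tcar wd' (tr_sort (reconst_pre C fn) g s)) :
  same_car (fn := fn) (g := g) (v := v) (wd := wd) (wd' := wd') (s := s) x1 y1 ->
  same_car (fn := fn) (g := g) (v := v) (wd := wd) (wd' := wd') (s := s) x2 y2 ->
  x1 = x2 <-> y1 = y2.
Proof.
case: s x1 x2 y1 y2 => [r x1 x2 _ _ <- <-//|[o f] x1 x2 _ _ [e <-] [e' <-]].
have rect_inj T (P : T -> Type) a b (eab : a = b) x y :
  eq_rect a P x b eab = eq_rect a P y b eab -> x = y by case: _ / eab.
rewrite (Prop_irrelevance e' e); split => [->//|].
exact: (@rect_inj _ (fun w => @flcar _ K w f) _ _ e).
Qed.

Lemma agreeS (D : signature) N C K fn fc v (F G : set {s : esort D & cst s}) :
  F `<=` G -> @agree D N C K fn fc v G -> @agree D N C K fn fc v F.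
Proof. by move=> FG h s c /FG; exact: h. Qed.

Lemma existT_inj (T : Type) (P : T -> Type) (a : T) (x y : P a) :
  existT P a x = existT P a y -> x = y.
Proof.
move=> e.
have /(_ _ _ e) : forall u v (e : u = v), eq_rect (projT1 u) P (projT2 u) _
  (congr1 (@projT1 _ _) e) = projT2 v by move=> u v; case: _ /.
by move: (congr1 _ e) => /= q; rewrite (Prop_irrelevance q (erefl a)).
Qed.

(** * Constants under binders *)

Definition drop_ext (D : signature) (C : esort D -> Type)
    (F : set {s : esort (ext C) & cst s}) : set {s : esort D & cst s} :=
  [set x | F (match x with
    | existT (Some r) c => existT (@cst (ext C)) (Some r) (inl c)
    | existT None k => existT (@cst (ext C)) None (inl k)
    end)].

Lemma finite_drop_ext (D : signature) (C : esort D -> Type)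
    (F : set {s : esort (ext C) & cst s}) :
  finite_set F -> finite_set (drop_ext F).
Proof.
move=> finF; apply: finite_preimage => //.
case=> [[r|] c] [[r'|] c'] _ _ e; move: (congr1 (@projT1 _ _) e) => //=.
  by case=> er; subst r'; have [->] := existT_inj e.
by move=> _; have [->] := existT_inj e.
Qed.

Section Lifting.
Variables (D : signature) (N : Type) (C : rsort D -> Type).
Variables (K : kripke (@reconst D N C)) (fn : nom D -> N).
Variable fc : forall s, rcst D s -> @rterm (reconst N C) s.
Variable v : forall s : esort D, cst s -> @dom (reconst N C) K s.
Variables (E : esort D -> Type) (E' : esort (@reconst D N C) -> Type).
Variable h : forall s, E s -> E' (omap id s).
Variable u : forall s : esort D, E s -> @dom (reconst N C) K s.
Variable u' : forall s, E' s -> dom K s.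

(** [omap id s] reduces to [s] only for [s] in constructor form, so the identity is given by
    cases. *)
Definition dom_omap (s : esort D) :
    @dom (reconst N C) K (omap id s) -> @dom (reconst N C) K s :=
  match s return @dom (reconst N C) K (omap id s) -> @dom (reconst N C) K s with
  | Some r => id
  | None => id
  end.

Definition ext_val (s : esort (ext E)) :
    cst s -> @dom (ext E') (@expand (reconst N C) K E' u') s :=
  match s return cst s -> @dom (ext E') (@expand (reconst N C) K E' u') s with
  | Some r => fun c => match c with inl c => @v (Some r) c | inr x => @u (Some r) x end
  | None => fun c => match c with inl c => @v None c | inr x => @u None x end
  end.

(** This is what the induction hypothesis for the body of a binder asks for: free constants agree by
    assumption, bound ones by the choice of their values. *)
Lemma agree_lift (F : set {s : esort (ext E) & cst s}) :
  @agree D N C K fn fc (@v) (drop_ext F) ->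
  (forall s x, @u s x = dom_omap (u' (h x))) ->
  @agree (ext E) _ _ (@expand (reconst N C) K E' u')
    (mnom (tr_lift (m := reconst_trans fn fc) h))
    (tr_cst (tr_lift (m := reconst_trans fn fc) h)) ext_val F.
Proof.
move=> agF hu [r|] [c|x] cF /=.
- rewrite (agF (Some r)) //=; apply/esym; exact: eval_rterm_incl.
- move: (hu (Some r) x) => /=; done.
- exact: (agF None).
- exact: (hu None x).
Qed.

End Lifting.

(** This is the satisfaction condition and, as [F] is finite, also the fact
    that satisfaction depends on finitely many constants only. *)
Lemma sat_tr_sen (D : signature) (phi : sen D) :
  exists2 F : set {s : esort D & cst s}, finite_set F &
  forall N C fn fc (K : kripke (@reconst D N C)) v,
  @agree D N C K fn fc v F -> forall w : world K,
  sat phi (K := revalue (K := K) v) w <->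
  sat (tr_sen phi (reconst_trans fn fc)) w.
Proof.
elim: phi => {D} [D k|D s t1 t2|D n a p ts|D o n a p ts|D k phi IH|D phi IH|
  D n Phi IH|D phi IH|D n X phi IH|D a phi IH].
- exists [set existT _ None k] => // N C fn fc K v /(_ None k erefl) /= h w.
  by rewrite h.
- have [F1 fin1 H1] := heval_tr_hterm t1.
  have [F2 fin2 H2] := heval_tr_hterm t2.
  exists (F1 `|` F2); first by rewrite finite_setU.
  move=> N C fn fc K v h w /=.
  apply: same_car_inj.
    by apply: H1; apply: agreeS h => x; left.
  by apply: H2; apply: agreeS h => x; right.
- have /choice[F H] : forall i, exists F : set {s : esort D & cst s},
      finite_set F /\ forall N C fn fc (K : kripke (@reconst D N C)) v,
      @agree D N C K fn fc v F -> forall w : world K,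
      same_car (fn := fn) (v := v) (wd := tag_world (K := revalue (K := K) v) w)
        (heval (K := revalue (K := K) v) w (ts i))
        (heval w (tr_hterm (reconst_trans fn fc) (ts i))).
    by move=> i; have [F] := heval_tr_hterm (ts i); exists F.
  exists (\bigcup_i F i).
    by apply: bigcup_finite => // i _; case: (H i).
  move=> N C fn fc K v h w.
  have e i : heval (K := revalue (K := K) v) w (ts i) =
      heval w (tr_hterm (reconst_trans fn fc) (ts i)).
    by case: (H i) => _; apply; apply: agreeS h => x; exists i.
  by have := functional_extensionality_dep e => /= ->.
- have /choice[F H] : forall i, exists F : set {s : esort D & cst s},
      finite_set F /\ forall N C fn fc (K : kripke (@reconst D N C)) v,
      @agree D N C K fn fc v F -> forall w : world K,
      same_car (fn := fn) (v := v) (wd := tag_world (K := revalue (K := K) v) w)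
        (heval (K := revalue (K := K) v) w (ts i))
        (heval w (tr_hterm (reconst_trans fn fc) (ts i))).
    by move=> i; have [F] := heval_tr_hterm (ts i); exists F.
  exists ((if o is Some k then [set existT _ None k] else set0) `|`
    \bigcup_i F i).
    rewrite finite_setU; split; first by case: (o).
    by apply: bigcup_finite => // i _; case: (H i).
  move=> N C fn fc K v h w /=.
  have ho : tag_world (K := revalue (K := K) v) w o =
      tag_world (K := K) w (omap fn o).
    have hk k : o = Some k -> v None k = nomI K (fn k).
      by move=> eo; apply: (h None k); left; rewrite eo.
    by move: hk; case: (o) => //= k; apply.
  apply: same_at_rel => // i; apply: same_car_of.
  by case: (H i) => _; apply; apply: agreeS h => x; right; exists i.
- have [F finF H] := IH.
  exists (F `|` [set existT _ None k]); first by rewrite finite_setU.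
  move=> N C fn fc K v h w /=.
  have -> : v None k = nomI K (fn k) by apply: (h None); right.
  by apply: H; apply: agreeS h => x; left.
- have [F finF H] := IH; exists F => // N C fn fc K v h w /=.
  by split=> n; apply: contra_not n => /(H _ _ _ _ _ _ h).
- have /choice[F H] : forall i, exists F : set {s : esort D & cst s},
      finite_set F /\ forall N C fn fc (K : kripke (@reconst D N C)) v,
      @agree D N C K fn fc v F -> forall w : world K,
      sat (Phi i) (K := revalue (K := K) v) w <->
      sat (tr_sen (Phi i) (reconst_trans fn fc)) w.
    by move=> i; have [F] := IH i; exists F.
  exists (\bigcup_i F i).
    by apply: bigcup_finite => // i _; case: (H i).
  move=> N C fn fc K v h w /=.
  split=> -[i hi]; exists i; move: hi; apply (H i).2;
    by apply: agreeS h => x; exists i.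
- have [F finF H] := IH; exists (drop_ext F); first exact: finite_drop_ext.
  move=> N C fn fc K v h w /=.
  have hu s x : @znom_val D (revalue (K := K) v) w s x =
      dom_omap (znom_val (D := reconst N C) (K := K) w
        ((match s return znom s -> znom (omap id s) with
          | Some _ => id | None => id end) x)) by case: s x.
  exact: (H _ _ _ _ _ _ (agree_lift h hu) w).
- have [F finF H] := IH; exists (drop_ext F); first exact: finite_drop_ext.
  move=> N C fn fc K v h w /=.
  pose X' i := omap (mrs (reconst_trans fn fc)) (X i).
  pose emb s (x : fam X s) : fam X' (omap id s) :=
    match x in fam _ s return fam X' (omap id s) with Var i => Var X' i end.
  pose dom_omapV (s : esort D) :
      @dom (reconst N C) K s -> @dom (reconst N C) K (omap id s) :=
    match s return @dom (reconst N C) K s -> @dom (reconst N C) K (omap id s) with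
    | Some r => id | None => id end.
  have sat_lift (u : forall s, fam X s -> @dom (reconst N C) K s)
      (u' : forall s, fam X' s -> @dom (reconst N C) K s) :
      (forall s x, u s x = dom_omap (K := K) (s := s) (u' _ (emb s x))) ->
      sat phi (K := @expand D (revalue (K := K) v) _ u) w <->
      sat (tr_sen phi (tr_lift_fam (reconst_trans fn fc) X))
        (K := @expand (reconst N C) K _ u') w.
    by move=> hu; exact: (H _ _ _ _ _ _ (agree_lift h hu) w).
  split=> -[u hu].
    pose u' s (x : fam X' s) : @dom (reconst N C) K s :=
      match x in fam _ s return @dom (reconst N C) K s with
      | Var i => dom_omapV (X i) (u (X i) (Var X i)) end.
    exists u'; apply: (sat_lift u u' _).1 => // s [i] /=.
    by case: (X i) (u (X i) (Var X i)).
  pose u0 s (x : fam X s) := dom_omap (K := K) (s := s) (u _ (emb s x)).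
  exists u0; apply: (sat_lift u0 u _).2 => //.
- have [F finF H] := IH; exists F => // N C fn fc K v h w /=.
  split=> -[w'].
    move=> /(action_rel_revalue v) aw /(H _ _ _ _ _ _ h); exists w' => //.
  by move=> /(action_rel_revalue v) aw /(H _ _ _ _ _ _ h); exists w'.
Qed.

(** * Structures over a signature with new constants *)

Lemma sat_ext_incl (D : signature) (C : esort D -> Type) (phi : sen D)
    (K : kripke D) (v : forall s, C s -> dom K s) (w : world K) :
  @sat _ (mor_sen (ext_incl C) phi) (expand v) w <-> sat phi w.
Proof.
have [F finF H] := sat_tr_sen phi.
case: K v w => W Wi nI mI rc rci cI fI rI fc fci ffI fri v w.
pose K := Kripke Wi nI mI rci cI fI rI fci ffI fri.
by apply: iff_sym; apply: (H _ _ inl _ (expand (K := K) v) (@cval _ K)) => -[].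
Qed.

Lemma models_ext_incl (D : signature) (C : esort D -> Type) (T : set (sen D))
    (K : kripke D) (v : forall s, C s -> dom K s) :
  models (expand v) (mor_sen (ext_incl C) @` T) <-> models K T.
Proof.
split=> [h phi Tphi w|h _ [phi Tphi <-] w].
  by apply/(sat_ext_incl _ v); apply: h; exists phi.
by apply/sat_ext_incl; exact: h.
Qed.

Lemma kripke_extE (D : signature) (C : esort D -> Type) (K : kripke (ext C)) :
  exists (K0 : kripke D) (v : forall s, C s -> dom K0 s), K = expand v.
Proof.
case: K => W Wi nI mI rc rci cI fI rI fc fci ffI fri.
pose K0 := @Kripke D W Wi (fun k => nI (inl k)) mI rc rci
  (fun s c => cI s (inl c)) fI rI fc fci ffI fri.
pose v (s : esort D) : C s -> dom K0 s :=
  match s return C s -> dom K0 s with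
  | Some r => fun c => cI r (inr c)
  | None => fun c => nI (inr c)
  end.
exists K0, v.
apply: (f_equal2 (fun n c =>
  @Kripke (ext C) W Wi n mI rc rci c fI rI fc fci ffI fri)).
  by apply: functional_extensionality_dep => -[].
apply: functional_extensionality_dep => s.
by apply: functional_extensionality_dep => -[].
Qed.

Definition nocst (D : signature) (s : esort D) : Type := Empty_set.

Lemma sat_subst_incl (D : signature) (C : esort D -> Type)
    (th : subst (@nocst D) C) (phi : sen D)
    (K : kripke D) (v : forall s, C s -> dom K s) (w : world K) :
  @sat _ (subst_sen th (mor_sen (ext_incl (@nocst D)) phi)) (expand v) w <->
  sat phi w.
Proof.
pose u (s : esort D) (e : nocst s) : dom K s := match e with end.
rewrite -(sat_ext_incl (C := @nocst D) phi u).
have [F finF H] := sat_tr_sen (mor_sen (ext_incl (@nocst D)) phi).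
apply: iff_sym.
apply: (H _ _ _ _ (expand v) (@cval _ (expand u))) => -[r|] [c|[]] _ //=.
Qed.

Lemma expand_support (D : signature) (Y : esort D -> Type)
    (C : esort (ext Y) -> Type) (phi : sen (ext C)) :
  exists2 F : set {s : esort D & Y s}, finite_set F &
  forall (K : kripke D) (y y' : forall s, Y s -> dom K s)
    (c : forall s : esort D, C s -> dom K s),
  (forall s e, F (existT _ s e) -> y s e = y' s e) ->
  gsat (@expand (ext Y) (expand y) C c) phi ->
  gsat (@expand (ext Y) (expand y') C c) phi.
Proof.
have [F finF H] := sat_tr_sen phi.
pose emb (x : {s : esort D & Y s}) : {s : esort (ext C) & cst s} :=
  match x with
  | existT (Some r) e => existT (@cst (ext C)) (Some r) (inl (inr e))
  | existT None e => existT (@cst (ext C)) None (inl (inr e))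
  end.
exists (emb @^-1` F).
  apply: finite_preimage => // -[[r|] e] [[r'|] e'] _ _ ee;
    move: (congr1 (@projT1 _ _) ee) => //=.
    by case=> er; subst r'; have [->] := existT_inj ee.
  by move=> _; have [->] := existT_inj ee.
move=> K y y' c yy h w.
pose Ky := @expand (ext Y) (expand y) C c.
pose Ky' := @expand (ext Y) (expand y') C c.
(* The identity translation evaluated in [Ky] mediates between the two valuations. *)
have H1 := H _ _ id (fun s c => TCst (D := ext C) (nom (ext C)) c) Ky.
apply/(H1 (@cval _ Ky')).
  case=> [r|] [[e|e]|e] //= eF; apply: esym.
    exact: (yy (Some r)).
  exact: (yy None).
by apply/(H1 (@cval _ Ky)) => [[]//|]; exact: h.
Qed.

(** * Cardinals *)

Lemma card_le_fun (T U : Type) (X : set T) (Y : set U) : X #<= Y -> inhabited U ->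
  exists f : T -> U, (forall x, X x -> Y (f x)) /\
    forall x y, X x -> X y -> f x = f y -> x = y.
Proof.
elim/Ppointed: U => U in Y *; first by move=> _ [u]; case: (no u).
move=> /pcard_leP[f] _; exists f; split=> [x|x y Xx Xy].
  exact: 'funS_f.
by apply: inj; exact/mem_set.
Qed.

Lemma fun_card_le (T U : Type) (X : set T) (Y : set U) (f : T -> U) :
  (forall x, X x -> Y (f x)) ->
  (forall x y, X x -> X y -> f x = f y -> x = y) -> X #<= Y.
Proof.
move=> fY injf; have : f @` X #= X.
  by apply: inj_card_eq => x y /set_mem ? /set_mem ?; exact: injf.
rewrite card_eq_le => /andP[_ XfX]; apply: card_le_trans XfX _.
by apply: subset_card_le => _ [x Xx <-]; exact: fY.
Qed.

Lemma card_leTP (T U : Type) :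
  [set: T] #<= [set: U] <-> exists f : T -> U, injective f.
Proof.
split=> [TU|[f injf]]; last by apply: (@fun_card_le _ _ _ _ f) => // x y _ _; exact: injf.
have [[u _]|Un] := pselect (exists u : U, True).
  by have [f [_ injf]] := card_le_fun TU (inhabits u); exists f => x y; exact: injf.
suff T0 : T -> False by exists (fun x => match T0 x with end) => x; case: (T0 x).
move=> t; apply: Un; have : [set: U] != set0.
  apply/eqP => U0; move: TU; rewrite U0 card_le0 => /eqP T0.
  by have : [set: T] t by []; rewrite T0.
by case/set0P => u _; exists u.
Qed.

Lemma card_le_setX (T U T' U' : Type) (X : set T) (Y : set U)
    (X' : set T') (Y' : set U') :
  X #<= Y -> X' #<= Y' -> inhabited U -> inhabited U' ->
  X `*` X' #<= Y `*` Y'.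
Proof.
move=> XY XY' Ui Ui'.
have [f [fY injf]] := card_le_fun XY Ui.
have [g [gY injg]] := card_le_fun XY' Ui'.
apply: (@fun_card_le _ _ _ _ (fun p => (f p.1, g p.2))).
  by move=> [x x'] [/= /fY ? /gY].
move=> [x x'] [y y'] [/= Xx Xx'] [/= Xy Xy'] [/injf -> // /injg -> //].
Qed.

(** Hilbert's hotel: shifting along an injective sequence in the rest of [X] makes room for [x]. *)
Lemma card_le_setD1 (T : Type) (X : set T) (x : T) :
  infinite_set X -> X #<= X `\ x.
Proof.
move=> infX.
have infY : infinite_set (X `\ x).
  move=> finY; apply: infX; apply: sub_finite_set (_ : finite_set (x |` (X `\ x))).
    by move=> y Xy; have [->|yx] := pselect (y = x); [left|right].
  by rewrite finite_setU.
have /infiniteP /card_le_fun /(_ (inhabits x)) [i [iY injio]] := infY.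
have {}injio n m : i n = i m -> n = m by exact: injio.
pose shift y := if pselect (y = x) then i 0
  else if pselect (exists n, y = i n) is left h then i (sval (cid h)).+1 else y.
have shift0 : shift x = i 0 by rewrite /shift; case: pselect.
have shiftS n : shift (i n) = i n.+1.
  rewrite /shift; case: (pselect (i n = x)) => [e|ne].
    by case: (iY n I) => _ /(_ e).
  case: pselect => [h|[]]; last by exists n.
  by case: cid => m /= /injio ->.
have shiftE y : y <> x -> (forall n, y <> i n) -> shift y = y.
  by move=> yx yi; rewrite /shift; case: pselect => // ?; case: pselect => // -[n e];
    case: (yi n e).
have shiftP y : [\/ y = x, exists n, y = i n | y <> x /\ forall n, y <> i n].
  have [?|yx] := pselect (y = x); first by constructor 1.
  have [?|yi] := pselect (exists n, y = i n); first by constructor 2.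
  by constructor 3; split=> // n e; apply: yi; exists n.
apply: (@fun_card_le _ _ _ _ shift).
  move=> y Xy; case: (shiftP y) => [->|[n ->]|[yx yi]].
  - by rewrite shift0; exact: iY.
  - by rewrite shiftS; exact: iY.
  - by rewrite shiftE.
move=> y z _ _; case: (shiftP y) (shiftP z) => [->|[n ->]|[yx yi]] [->|[m ->]|[zx zi]];
  rewrite ?shift0 ?shiftS ?(shiftE y) ?(shiftE z) //.
- by move/injio.
- by move=> e; case: (zi 0).
- by move/injio.
- by move/injio => -[->].
- by move=> e; case: (zi n.+1).
- by move=> e; case: (yi 0).
- by move=> e; case: (yi m.+1).
Qed.

(** * The square of an infinite cardinal *)

Section Cardinal.
Variable A : cardinal.

Lemma olt_irr (a : A) : ~ olt a a.
Proof. by elim/(well_founded_ind (@olt_wf A)): a => a IH aa; exact: (IH a). Qed.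

Lemma ole_trans (a b c : A) : ole a b -> ole b c -> ole a c.
Proof.
by move=> [ab|->] // [bc|<-]; left => //; exact: olt_trans ab bc.
Qed.

Lemma ole_lt_trans (a b c : A) : ole a b -> olt b c -> olt a c.
Proof. by move=> [ab|->] // bc; exact: olt_trans ab bc. Qed.

Lemma olt_le_trans (a b c : A) : olt a b -> ole b c -> olt a c.
Proof. by move=> ab [bc|<-] //; exact: olt_trans ab bc. Qed.

Lemma olt_or_ge (a b : A) : olt a b \/ ole b a.
Proof.
by case: (olt_total a b) => [|[->|]]; [left|right; right|right; left].
Qed.

Definition seg (a : A) : set A := [set b | ole b a].

Definition omax (a b : A) : A := if `[< olt a b >] then b else a.

Lemma omaxP (a b : A) : ole a (omax a b) /\ ole b (omax a b).
Proof.
rewrite /omax; case: asboolP => ab; first by split; [left|right].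
by split; [right|case: (olt_or_ge a b)].
Qed.

(** Gödel's ordering of pairs. The maximum is compared first, so that the predecessors of a pair are
    confined to the square of a segment. *)
Definition godel_lt (p q : A * A) : Prop :=
  slexprod A (A * A) (@olt A) (slexprod A A (@olt A) (@olt A))
    (omax p.1 p.2, p) (omax q.1 q.2, q).

Lemma godel_wf : well_founded godel_lt.
Proof.
apply: (wf_inverse_image _ _ _ (fun p => (omax p.1 p.2, p))).
by do 2?apply: wf_slexprod; exact: olt_wf.
Qed.

Lemma godel_total p q : [\/ godel_lt p q, p = q | godel_lt q p].
Proof.
rewrite /godel_lt.
case: (olt_total (omax p.1 p.2) (omax q.1 q.2)) => [pq|[e|qp]].
- by constructor 1; left.
- rewrite e; case: p q {e} => [p1 p2] [q1 q2].
  case: (olt_total p1 q1) => [pq|[<-|qp]].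
  + by constructor 1; right; left.
  + case: (olt_total p2 q2) => [pq|[<-|qp]].
    * by constructor 1; right; right.
    * by constructor 2.
    * by constructor 3; right; right.
  + by constructor 3; right; left.
- by constructor 3; left.
Qed.

Lemma godel_seg p q : godel_lt p q ->
  seg (omax q.1 q.2) p.1 /\ seg (omax q.1 q.2) p.2.
Proof.
move=> pq; have pqm : ole (omax p.1 p.2) (omax q.1 q.2).
  rewrite /godel_lt in pq; inversion pq; [by left|by right].
by have [? ?] := omaxP p.1 p.2; split; apply: ole_trans pqm.
Qed.

(** The enumeration of [E `*` E] along the ordering of its elements by their
    maximum first never exhausts [E]. *)
Lemma card_setX_seg (E : set A) :
  (forall x, E x -> ~ (E #<= seg x `*` seg x)) -> E `*` E #<= E.
Proof.
move=> small.
(* Each pair takes an element of [E] not taken by an earlier pair; the default [q.1] is never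
   reached on pairs from [E]. *)
pose step q (rec : forall p, godel_lt p q -> A) : A :=
  if pselect (exists e, E e /\ forall p h, rec p h <> e) is left h
  then sval (cid h) else q.1.
pose F := Fix godel_wf (fun _ => A) step.
have FE q : F q = step q (fun p _ => F p).
  apply: (Fix_eq godel_wf (fun _ => A) step) => x f g fg.
  suff -> : f = g by [].
  apply: functional_extensionality_dep => y.
  by apply: functional_extensionality_dep => h; exact: fg.
have Fnew q : E q.1 -> E q.2 -> E (F q) /\ forall p, godel_lt p q -> F p <> F q.
  move=> E1 E2; rewrite [F q]FE /step; case: pselect => [h|none].
    by case: cid => e /= [Ee en].
  have Em : E (omax q.1 q.2) by rewrite /omax; case: asboolP.
  case: (small _ Em).
  apply: card_le_trans (card_image_le F _); apply: subset_card_le => e Ee.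
  apply: contrapT => ne; apply: none; exists e; split => // p /godel_seg h Fp.
  by apply: ne; exists p.
apply: (@fun_card_le _ _ _ _ F) => [p [E1 E2]|p q [p1 p2] [q1 q2] e].
  by case: (Fnew p E1 E2).
case: (godel_total p q) => // lt.
  by case: (Fnew q q1 q2) => _ /(_ _ lt).
by case: (Fnew p p1 p2) => _ /(_ _ lt); rewrite e.
Qed.

Lemma seg_lt_setD1 (x : A) : seg x `\ x = [set b | olt b x].
Proof.
apply/seteqP; split=> [b [[|//]]|b bx]; first by [].
by split; [left|move=> e; move: bx; rewrite e; exact: olt_irr].
Qed.

(** Either [seg x] embeds in an earlier segment, to which induction applies, or it is too large for
    the squares of all earlier segments, and its pairs can be enumerated. *)
Lemma card_seg_setX (x : A) :
  infinite_set (seg x) -> seg x `*` seg x #<= seg x.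
Proof.
elim/(well_founded_ind (@olt_wf A)): x => x IH infx.
have [[y yx xy]|ninj] := pselect (exists2 y, olt y x & seg x #<= seg y).
  have infy : infinite_set (seg y) by move=> /(card_le_finite xy).
  apply: card_le_trans (card_le_setX xy xy (inhabits x) (inhabits x)) _.
  apply: card_le_trans (IH _ yx infy) _.
  by apply: subset_card_le => z zy; left; exact: ole_lt_trans zy yx.
(* The strict segment has the same size, and its elements [y] are all strictly below [x], as [ninj]
   requires. *)
pose E := [set b | olt b x].
have xE : seg x #<= E by rewrite /E -seg_lt_setD1; exact: card_le_setD1.
apply: card_le_trans (card_le_setX xE xE (inhabits x) (inhabits x)) _.
apply: card_le_trans (_ : E #<= seg x); last by apply: subset_card_le => y; left.
apply: card_setX_seg => y yx Ey; apply: ninj; exists y => //.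
apply: (card_le_trans xE); apply: (card_le_trans Ey); apply: IH => // finy.
by apply: infx; apply: (card_le_finite xE); apply: (card_le_finite Ey); exact: finite_setX.
Qed.

Lemma card_setXT : infinite_card A -> [set: A * A] #<= [set: A].
Proof.
move=> infA; rewrite -setXTT; apply: card_setX_seg => x _ Ax.
have [finx|infx] := pselect (finite_set (seg x)).
  by apply: infA; apply: (card_le_finite Ax); exact: finite_setX.
apply: (@olt_initial A x); apply: card_le_trans Ax _.
apply: card_le_trans (card_seg_setX infx) _.
by rewrite -seg_lt_setD1; exact: card_le_setD1.
Qed.

End Cardinal.

Lemma card_le_sum (A : cardinal) (T U : Type) : infinite_card A ->
  [set: T] #<= [set: A] -> [set: U] #<= [set: A] ->
  [set: (T + U)%type] #<= [set: A].
Proof.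
move=> infA /card_leTP[f injf] /card_leTP[g injg].
have /infiniteP /card_leTP[i inji] := infA.
apply: card_le_trans (card_setXT infA); apply/card_leTP.
exists (fun x => match x with inl t => (f t, i 0) | inr u => (g u, i 1) end).
by case=> [t|u] [t'|u'] [] => [/injf ->|_ /inji|_ /inji|/injg ->].
Qed.

Lemma card_esort (A : cardinal) (D : signature) :
  power_le D A -> [set: esort D] #<= [set: A].
Proof.
move=> [natA /card_leTP[i inji]]; have infA : infinite_card A by apply/infiniteP.
apply: (@card_le_trans _ _ _ [set: (rsort D + unit)%type]).
  apply/card_leTP; exists (fun s => if s is Some r then inl r else inr tt).
  by case=> [r|] [r'|] // [->].
apply: card_le_sum => //; apply/card_leTP.
  by exists (fun r => i (SymSort (inl r))) => r r' /inji [].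
by have /card_leTP[j _] := natA; exists (fun _ => j 0) => -[] [].
Qed.

Lemma power_le_ext (A : cardinal) (D : signature) (C : esort D -> Type) :
  power_le D A -> (forall s, [set: C s] #<= [set: A]) -> power_le (ext C) A.
Proof.
move=> [natA symA] CA; split => //.
have infA : infinite_card A by apply/infiniteP.
have esortA := card_esort (conj natA symA).
pose c s := sval (cid ((card_leTP _ _).1 (CA s))).
have injc s : injective (c s) by rewrite /c; case: cid.
have CsA : [set: {s : esort D & C s}] #<= [set: A].
  have /card_leTP[j injj] := esortA.
  apply: card_le_trans (card_setXT infA); apply/card_leTP.
  exists (fun x => (j (projT1 x), c _ (projT2 x))).
  by move=> [s x] [s' x'] /= [/injj es]; subst s' => /injc ->.
apply: (@card_le_trans _ _ _ [set: (symbol D + {s : esort D & C s})%type]);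
  last exact: card_le_sum.
apply/card_leTP.
pose f (x : symbol (ext C)) : symbol D + {s : esort D & C s} :=
  match x with
  | SymNom (inl k) => inl (SymNom k)
  | SymNom (inr c) => inr (existT _ None c)
  | SymModal l => inl (SymModal (D := D) l)
  | SymSort s => inl (SymSort (D := D) s)
  | SymRcst s (inl c) => inl (SymRcst c)
  | SymRcst s (inr c) => inr (existT _ (Some s) c)
  | SymRfun n a s g => inl (SymRfun (D := D) g)
  | SymRrel n a p => inl (SymRrel (D := D) p)
  | SymFlfun n a s g => inl (SymFlfun (D := D) g)
  | SymFlrel n a p => inl (SymFlrel (D := D) p)
  end.
(* A left inverse of [f] gives injectivity without inverting equalities between dependent
   symbols. *)
pose g (x : symbol D + {s : esort D & C s}) : symbol (ext C) :=
  match x with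
  | inl (SymNom k) => SymNom (D := ext C) (inl k)
  | inl (SymModal l) => SymModal (D := ext C) l
  | inl (SymSort s) => SymSort (D := ext C) s
  | inl (SymRcst s c) => SymRcst (D := ext C) (s := s) (inl c)
  | inl (SymRfun n a s g) => SymRfun (D := ext C) g
  | inl (SymRrel n a p) => SymRrel (D := ext C) p
  | inl (SymFlfun n a s g) => SymFlfun (D := ext C) g
  | inl (SymFlrel n a p) => SymFlrel (D := ext C) p
  | inr (existT None c) => SymNom (D := ext C) (inr c)
  | inr (existT (Some s) c) => SymRcst (D := ext C) (s := s) (inr c)
  end.
exists f; apply: (can_inj (g := g)).
by case=> //= [[]|s []].
Qed.

(** * Regular cardinals and linear orders of given cofinality *)

Section Regular.
Variable A : cardinal.
Hypothesis regA : regular A.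

(** Otherwise the values of [b] on [S] would be cofinal, hence at least [A] many. *)
Lemma regular_bounded (T : Type) (S : set T) (b : T -> A) :
  ~ ([set: A] #<= S) -> exists d, forall x, S x -> olt (b x) d.
Proof.
move=> nAS; apply: contrapT => unb; apply: nAS.
apply: card_le_trans (card_image_le b S); apply: regA.2.2 => d.
apply: contrapT => nc; apply: unb; exists d => x Sx.
by case: (olt_or_ge (b x) d) => // db; case: nc; exists (b x) => //; exists x.
Qed.

Lemma regular_finite_bounded (T : Type) (S : set T) (b : T -> A) :
  finite_set S -> exists d, forall x, S x -> olt (b x) d.
Proof.
by move=> finS; apply: regular_bounded => /card_le_finite/(_ finS); exact: regA.1.
Qed.

Lemma regular_unbounded (a : A) : exists b, olt a b.
Proof.
by have [d /(_ a erefl)] := regular_finite_bounded id (finite_set1 a); exists d.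
Qed.

Lemma linear_order_exists (T : Type) : exists le : T -> T -> Prop, linear_order le.
Proof.
have [R woR] := well_ordering_principle {classic T}.
have wo : @wo_chain {classic T} R predT by exact: withinW woR.
have tot x y : R x y || R y x by exact: (wo_chainW wo).
have anti x y : R x y -> R y x -> x = y.
  by move=> xy yx; apply: (wo_chain_antisymmetric wo) => //; rewrite xy.
exists R; split=> //; first by move=> x; exact: (wo_chain_reflexive wo).
  move=> x y z xy yz.
  (* Transitivity comes from the least of the three elements: unless it is [x], antisymmetry
     identifies two of them. *)
  have [|m [[mA mmin] _]] := woR [pred t : {classic T} | [|| t == x, t == y | t == z]].
    by exists x; rewrite inE eqxx.
  have [mx my mz] : [/\ R m x, R m y & R m z].
    by split; apply: mmin; rewrite inE eqxx ?orbT.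
  case/or3P: mA => /eqP em; subst m => //.
    by rewrite (anti x y).
  by rewrite -(anti y z).
by move=> x y; exact/orP.
Qed.

Lemma linear_order_cofinality (U : Type) : [set: A] #<= [set: U] ->
  exists le : U -> U -> Prop, linear_order le /\ has_cofinality le A.
Proof.
move=> /card_leTP[f injf]; have [lin [lrefl lanti ltrans ltot]] := linear_order_exists U.
pose top x := exists a, x = f a.
pose le x y := [\/ ~ top x /\ top y, [/\ ~ top x, ~ top y & lin x y] |
  exists a b, [/\ x = f a, y = f b & ole a b]].
have letop a b : le (f a) (f b) <-> ole a b.
  split=> [[[]|[]|[a' [b' []]]]|ab].
  - by case; exists a.
  - by case; exists a.
  - by move=> /injf -> /injf ->.
  - by constructor 3; exists a, b.
(* The copy of [A] is closed upwards, so a set cofinal for [le] meets it in a cofinal subset. *)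
have le_top a y : le (f a) y -> exists2 b, y = f b & ole a b.
  by case=> [[]|[]|[a' [b' [/injf -> -> ab]]]]; [case; exists a|case; exists a|exists b'].
exists le; split; first split.
- move=> x; have [[a ->]|nx] := pselect (top x); first by apply/letop; right.
  by constructor 2.
- move=> x y; have [[a ->]|nx] := pselect (top x).
    move=> /le_top[b -> [ab|-> //]] /letop [ba|-> //].
    by case: (@olt_irr A a); exact: olt_trans ab ba.
  move=> xy; have [[b ->]|ny] := pselect (top y).
    by move=> /le_top[a ex _]; case: nx; exists a.
  case: xy => [[_ //]|[_ _ xy]|[a [b [ex _ _]]]]; last by case: nx; exists a.
  by case=> [[_ //]|[_ _ yx]|[a [b [ey _ _]]]]; [exact: lanti|case: ny; exists a].
- move=> x y z; have [[a ->]|nx] := pselect (top x).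
    move=> /le_top[b -> ab] /le_top[c -> bc]; apply/letop; exact: ole_trans bc.
  move=> xy yz; have [tz|nz] := pselect (top z); first by constructor 1.
  constructor 2; split=> //.
  case: yz => [[_ //]|[ny _ yz]|[b [c [_ ez _]]]]; last by case: nz; exists c.
  case: xy => [[_ //]|[_ _ xy]|[a [b [ex _ _]]]]; last by case: nx; exists a.
  exact: ltrans xy yz.
- move=> x y; have [[a ->]|nx] := pselect (top x); have [[b ->]|ny] := pselect (top y).
  + by case: (olt_or_ge a b) => ab; [left; apply/letop; left|right; apply/letop].
  + by right; constructor 1; split=> //; exists a.
  + by left; constructor 1; split=> //; exists b.
  + by case: (ltot x y) => xy; [left|right]; constructor 2.
have [a0] : exists a0 : A, True.
  by have /infinite_setN0[a _] := regA.1; exists a.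
move=> _; split.
  exists (f @` [set: A]); last by apply: inj_card_eq => x y _ _; exact: injf.
  move=> x; have [[a ->]|nx] := pselect (top x).
    by exists (f a); [exists a|apply/letop; right].
  by exists (f a0); [exists a0|constructor 1; split=> //; exists a0].
move=> X cofX; apply: card_le_trans (regA.2.2 (f @^-1` X) _) _.
  by move=> a; have [y Xy /le_top[b eb ab]] := cofX (f a); exists b => //=; rewrite -eb.
by apply: card_ge_preimage => x y _ _; exact: injf.
Qed.

End Regular.

(** * Omitting types over new constants *)

(** The constants of an extension form a sum type only once the sort is known to be [any] or rigid;
    [cinl] and [cinr] are its injections for a variable sort. *)
Definition cinl (D : signature) (C : esort D -> Type) (s : esort D) :
    cst s -> @cst (ext C) s :=
  match s return cst s -> @cst (ext C) s with Some _ => inl | None => inl end.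

Definition cinr (D : signature) (C : esort D -> Type) (s : esort D) :
    C s -> @cst (ext C) s :=
  match s return C s -> @cst (ext C) s with Some _ => inr | None => inr end.

Lemma cval_inl (D : signature) (C : esort D -> Type) (K : kripke D)
    (v : forall s, C s -> dom K s) (s : esort D) (c : cst s) :
  cval (expand v) (cinl C c) = cval K c.
Proof. by case: s c. Qed.

Lemma cval_inr (D : signature) (C : esort D -> Type) (K : kripke D)
    (v : forall s, C s -> dom K s) (s : esort D) (c : C s) :
  cval (expand v) (cinr c) = v s c.
Proof. by case: s c. Qed.

(** The property belongs to the structure, so its sentence holds at all worlds or at none, and local
    and global satisfaction coincide. *)
Definition definable (L : fragment) (D : signature) (P : kripke D -> Prop) :=
  exists2 psi, fsen L psi & forall (K : kripke D) (w : world K), sat psi w <-> P K.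

Arguments definable L {D} P.

Section Definable.
Variables (L : fragment) (D : signature).
Hypotheses (eqL : closed_equality L) (atL : closed_retrieve L)
  (negL : closed_negation L) (orL : closed_disjunction L) (sigD : fsig L D).

(** For nominals, the equation is expressed by retrieving the sentence [b] at [a]. *)
Lemma definable_eq (s : esort D) (a b : cst s) :
  definable L (fun K => cval K a = cval K b).
Proof.
case: s a b => [r|] a b.
  have [psi Lpsi H] := (eqL sigD).2 _ (TCst (htag D) a) (TCst (htag D) b).
  by exists psi => // K w; apply: iff_trans (H K w) _.
have [psi Lpsi H] := (eqL sigD).1 b.
have [psi' Lpsi' H'] := atL sigD a Lpsi.
exists psi' => // K w; apply: iff_trans (H' K w) _ => /=.
by apply: iff_trans (H K _) _ => /=; split.
Qed.

Lemma definable_neg (P : kripke D -> Prop) :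
  definable L P -> definable L (fun K => ~ P K).
Proof.
move=> [psi Lpsi H]; have [psi' Lpsi' H'] := negL sigD Lpsi.
exists psi' => // K w; apply: iff_trans (H' K w) _ => /=.
by split=> n; apply: contra_not n => /H.
Qed.

Lemma definable_imp (P Q : kripke D -> Prop) :
  definable L P -> definable L Q -> definable L (fun K => P K -> Q K).
Proof.
move=> /definable_neg[psi Lpsi H] [psi' Lpsi' H'].
have [|chi Lchi Hchi] := orL sigD (n := 2) (Phi := fun i => if val i is 0 then psi else psi').
  by case=> -[|[|]].
exists chi => // K w; apply: iff_trans (Hchi K w) _ => /=; split.
  by case=> -[[|[|//]] lt] /= => [/H|/H'].
move=> PQ; have [p|np] := pselect (P K).
  by exists (@Ordinal 2 1 isT); apply/H'/PQ.
by exists (@Ordinal 2 0 isT); apply/H.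
Qed.

End Definable.

(** Taking all sentences that express a property of [Ax] avoids choosing one for each. *)
Definition sens (L : fragment) (D : signature) (Ax : set (kripke D -> Prop)) :
    set (sen D) :=
  [set psi | fsen L psi /\ exists2 P, Ax P &
     forall (K : kripke D) (w : world K), sat psi w <-> P K].

Lemma models_sens (L : fragment) (D : signature) (Ax : set (kripke D -> Prop))
    (K : kripke D) :
  Ax `<=` definable L -> models K (sens L Ax) <-> forall P, Ax P -> P K.
Proof.
move=> dAx; split=> [h P AxP|h psi [_ [P AxP H]] w]; last by apply/H; exact: h.
have [psi Lpsi H] := dAx P AxP; have [w] := world_inh K.
by apply/(H K w); apply: h; split=> //; exists P.
Qed.

Lemma modelsU (D : signature) (K : kripke D) (T U : set (sen D)) :
  models K (T `|` U) <-> models K T /\ models K U.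
Proof.
split=> [h|[hT hU] phi [/hT|/hU]] //.
by split=> phi ?; apply: h; [left|right].
Qed.

Lemma fsig_ext (L : fragment) (D : signature) (C : esort D -> Type) :
  fsig L D -> fsig L (ext C).
Proof. by move=> /fmor_incl /(_ C) /fmor_cod. Qed.

Lemma fsen_ext_incl (L : fragment) (D : signature) (C : esort D -> Type)
    (T : set (sen D)) :
  fsig L D -> T `<=` @fsen L D ->
  mor_sen (ext_incl C) @` T `<=` @fsen L (ext C).
Proof. by move=> sD TL _ [phi /TL Lphi <-]; apply: fsen_mor Lphi; exact: fmor_incl. Qed.

(** The omitting types property for [T] and [Ax] over the constants [Y], with types that have no
    variables: such a type is omitted when one of its properties fails. If the theory does not omit
    a type, fewer than [A] sentences [p], consistent with it, entail that type. *)
Lemma omit_or_realize (L : fragment) (A : cardinal) (D : signature)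
    (T : set (sen D)) (Y : esort D -> Type) (Ax : set (kripke (ext Y) -> Prop))
    (J : Type) (G : J -> set (kripke (ext Y) -> Prop)) :
  regular A -> omitting_types_property L A -> fsig L D -> power_le D A ->
  T `<=` @fsen L D -> (forall s, [set: Y s] #<= [set: A]) ->
  [set: J] #<= [set: A] -> inhabited J ->
  Ax `<=` definable L -> (forall j, G j `<=` definable L) ->
  (exists (K : kripke D) (y : forall s, Y s -> dom K s),
     models K T /\ forall P, Ax P -> P (expand y)) ->
  (exists (K : kripke D) (y : forall s, Y s -> dom K s),
     [/\ models K T, forall P, Ax P -> P (expand y) &
       forall j, exists2 P, G j P & ~ P (expand y)]) \/
  exists (j : J) (C : esort (ext Y) -> Type) (p : set (sen (ext C))),
  [/\ forall s, card_lt [set: C s] A, p `<=` @fsen L (ext C), card_lt p A,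
      exists (K : kripke D) (y : forall s, Y s -> dom K s)
        (c : forall s : esort D, C s -> dom K s),
      [/\ models K T, forall P, Ax P -> P (expand y) &
        models (@expand (ext Y) (expand y) C c) p]
    & forall (K : kripke D) (y : forall s, Y s -> dom K s)
        (c : forall s : esort D, C s -> dom K s),
      models K T -> (forall P, Ax P -> P (expand y)) ->
      models (@expand (ext Y) (expand y) C c) p ->
      forall P, G j P -> P (expand y)].
Proof.
move=> regA otp sigD powD TL YA JA [j0] dAx dG [K0 [y0 [K0T K0Ax]]].
have [f injf] := (card_leTP _ _).1 JA.
(* Types have to be indexed by [A]: [J] embeds in [A], and [j0] fills the remaining indices. *)
pose g a := if pselect (exists j, f j = a) is left h then sval (cid h) else j0.
have fK j : g (f j) = j.
  rewrite /g; case: pselect => [h|[]]; last by exists j.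
  by case: cid => j' /= /injf.
have sigY : fsig L (ext Y) by exact: fsig_ext.
pose T' := mor_sen (ext_incl Y) @` T `|` sens L Ax.
have T'L : T' `<=` @fsen L (ext Y).
  by move=> phi [/fsen_ext_incl|[]//]; exact.
have T'E (K : kripke D) (y : forall s, Y s -> dom K s) :
    models (expand y) T' <-> models K T /\ forall P, Ax P -> P (expand y).
  rewrite modelsU models_sens //; split=> -[h1 h2]; split=> //.
    exact: (models_ext_incl _ _).1 h1.
  exact: (models_ext_incl _ _).2 h1.
pose X (_ : A) := @nocst (ext Y).
pose G' a := mor_sen (ext_incl (X a)) @` sens L (G (g a)).
have G'L a : G' a `<=` @fsen L (ext (X a)).
  by apply: fsen_ext_incl => // phi [].
have finX a s : finite_set [set: X a s].
  by rewrite (_ : [set: _] = set0) //; apply/seteqP; split=> -[].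
have satT' : satisfiable T' by exists (expand y0); apply/T'E.
have [om|] := pselect (forall a, card_omits L A T' (G' a)).
  left; have [K' [K'T om']] := otp _ sigY (power_le_ext powD YA) _ T'L satT' _ _ finX G'L om.
  have [K [y eK]] := kripke_extE K'; subst K'; exists K, y.
  have [KT KAx] := (T'E K y).1 K'T; split=> // j.
  apply: contrapT => nP; apply: (om' (f j)).
  exists (fun s (e : Empty_set) => match e with end).
  apply/models_ext_incl/models_sens; first exact: dG.
  move=> P; rewrite fK => GP; apply: contrapT => nPK; apply: nP; by exists P.
move=> /existsNP[a /contrapT[C [th [p [CA pL pA [K' K'm] ent]]]]].
right; exists (g a), C, p; split=> //.
  have [K1 [c eK]] := kripke_extE K'; subst K'.
  have [K [y eK]] := kripke_extE K1; subst K1.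
  move/modelsU: K'm => [/models_ext_incl /T'E [KT KAx] Kp].
  by exists K, y, c.
move=> K y c KT KAx Kp P GP.
have [psi Lpsi H] := dG _ _ GP; have [w] := world_inh K.
apply: (H (expand y) w).1.
apply: (@sat_subst_incl (ext Y) C th psi (expand y) c w).1.
apply: ent; last first.
  exists (mor_sen (ext_incl (X a)) psi) => //.
  by exists psi => //; split=> //; exists P.
by apply/modelsU; split=> //; apply/models_ext_incl/T'E.
Qed.

(** The indices of the finitely many constants of one sentence are bounded; by regularity, so are
    these bounds for all sentences of [p]. *)
Lemma bounded_support (A : cardinal) (D : signature) (Y : esort D -> Type)
    (C : esort (ext Y) -> Type) (p : set (sen (ext C)))
    (idx : forall s, Y s -> A) :
  regular A -> ~ ([set: A] #<= p) ->
  exists d, forall (K : kripke D) (y y' : forall s, Y s -> dom K s)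
    (c : forall s : esort D, C s -> dom K s),
  (forall s e, olt (idx s e) d -> y s e = y' s e) ->
  models (@expand (ext Y) (expand y) C c) p ->
  models (@expand (ext Y) (expand y') C c) p.
Proof.
move=> regA Ap.
have /choice[b bP] : forall phi : sen (ext C), exists b,
    forall (K : kripke D) (y y' : forall s, Y s -> dom K s)
    (c : forall s : esort D, C s -> dom K s),
    (forall s e, olt (idx s e) b -> y s e = y' s e) ->
    gsat (@expand (ext Y) (expand y) C c) phi ->
    gsat (@expand (ext Y) (expand y') C c) phi.
  move=> phi; have [F finF H] := expand_support phi.
  have [b bP] := regular_finite_bounded regA (fun x => idx (projT1 x) (projT2 x)) finF.
  by exists b => K y y' c yy; apply: H => s e /bP; exact: yy.
have [d dP] := regular_bounded regA b Ap.
exists d => K y y' c yy h phi pphi; apply: (bP phi _ y); last exact: h.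
by move=> s e se; apply: yy; apply: olt_trans se _; exact: dP.
Qed.

(** * Large models *)

Lemma wf_minimal (T : Type) (R : T -> T -> Prop) (P : T -> Prop) (x : T) :
  well_founded R -> P x -> exists2 y, P y & forall z, P z -> ~ R z y.
Proof.
move=> wfR; elim/(well_founded_ind wfR): x => x IH Px.
have [[z [Pz zx]]|none] := pselect (exists z, P z /\ R z x); first exact: IH zx Pz.
by exists x => // z Pz zx; apply: none; exists z.
Qed.

Definition cofinal_seq (A : cardinal) (a : A) (q : nat -> A) : Prop :=
  (forall n, olt (q n) a) /\ forall b, olt b a -> exists n, olt b (q n).

(** Elements of [U] chosen one above the other form a sequence, bounded since [A] is regular and
    uncountable. Its least strict upper bound is the limit point. *)
Lemma unbounded_cofinal_seq (A : cardinal) (U : set A) :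
  regular A -> ~ ([set: A] #<= [set: nat]) ->
  (forall b, exists2 a, olt b a & U a) ->
  exists a q, cofinal_seq a q /\ forall n, U (q n).
Proof.
move=> regA unctbl unbU.
have /choice[h hP] : forall b, exists a, olt b a /\ U a.
  by move=> b; have [a] := unbU b; exists a.
have [a0 _] := infinite_setN0 regA.1.
(* Starting with one application of [h] leaves out [a0], which may lie outside [U]. *)
pose q n := iter n.+1 h a0.
have qS n : olt (q n) (q n.+1) by case: (hP (q n)).
have [d dP] := regular_bounded regA q unctbl.
have [a aP amin] := wf_minimal (P := fun a => forall n, olt (q n) a)
  (@olt_wf A) (fun n => dP n I).
exists a, q; split; last by move=> n; case: (hP (iter n h a0)).
split=> // b ba; apply: contrapT => nb; apply: (amin b _ ba) => n.
case: (olt_or_ge (q n) b) => // bq; case: nb; exists n.+1.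
exact: ole_lt_trans bq (qS n).
Qed.

(** New constants code a subset [U] of [A], where [var false b] is different
    from the constant named by [e 0] iff [b] belongs to [U], and for each [a] of
    cofinality omega a bound, named by [var true a], of [U] below [a].  The
    named sort has no other elements than the named ones, so that the bound
    exists, and [U] has no limit point of cofinality omega.  But sets of fewer
    than [A] sentences do not bound [U]. *)
Lemma named_sort_absurd (L : fragment) (A : cardinal) (D : signature)
    (T : set (sen D)) (s : esort D) (J : Type) (nm : J -> cst s)
    (e : nat -> J) :
  closed_equality L -> closed_retrieve L -> closed_negation L ->
  closed_disjunction L -> regular A -> ~ ([set: A] #<= [set: nat]) ->
  omitting_types_property L A -> fsig L D -> power_le D A ->
  T `<=` @fsen L D -> satisfiable T ->
  (forall K, models K T -> forall u : dom K s, exists j, cval K (nm j) = u) ->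
  (forall K, models K T -> injective (fun n => cval K (nm (e n)))) ->
  False.
Proof.
move=> eqL atL negL orL regA unctbl otp sigD powD TL [M MT] named inje.
have infA : infinite_card A by exact: regA.1.
pose val j := cval M (nm j).
(* The number coded by the name [j] in the fixed model [M]; names of elements other than the [e n]
   code 0. *)
pose f j := if pselect (exists n, val (e n) = val j) is left h
  then sval (cid h) else 0.
have fe n j : val j = val (e n) -> f j = n.
  move=> ej; rewrite /f; case: pselect => [h|[]]; last by exists n.
  by case: cid => m /=; rewrite ej => /(inje M MT).
pose lim a := exists q : nat -> A, cofinal_seq a q.
have [a0 _] := infinite_setN0 regA.1.
have /choice[q qP] : forall a, exists q : nat -> A, lim a -> cofinal_seq a q.
  move=> a; have [[q qa]|nl] := pselect (lim a); first by exists q.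
  by exists (fun _ => a0).
pose Y (s' : esort D) : Type := ((s = s') * (bool * A))%type.
pose var b a : @cst (ext Y) s := cinr (C := Y) (erefl, (b, a)).
pose nmY j : @cst (ext Y) s := cinl Y (nm j).
pose out a (K : kripke (ext Y)) := cval K (var false a) = cval K (nmY (e 0)).
(* The first two clauses impose on names the equalities and inequalities of [M], so that [f] makes
   sense in all models. By the third, if [var true a] codes [n], no element of [U] lies strictly
   between [q a n] and [a]. *)
pose Ax : set (kripke (ext Y) -> Prop) := [set P |
  [\/ exists i j, val i = val j /\ P = (fun K => cval K (nmY i) = cval K (nmY j)),
      exists i j, val i <> val j /\ P = (fun K => cval K (nmY i) <> cval K (nmY j))
    | exists a b j, [/\ lim a, olt (q a (f j)) b, olt b a &
        P = (fun K => cval K (var true a) = cval K (nmY j) -> out b K)]]].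
pose G (a : A) : set (kripke (ext Y) -> Prop) :=
  [set P | exists2 b, olt a b & P = out b].
have sigY : fsig L (ext Y) by exact: fsig_ext.
have deq := definable_eq eqL atL sigY.
have dAx : Ax `<=` definable L.
  move=> P [[i [j [_ ->]]]|[i [j [_ ->]]]|[a [b [j [_ _ _ ->]]]]].
  - exact: deq.
  - by apply: definable_neg => //; exact: deq.
  - by apply: definable_imp => //; exact: deq.
have dG a : G a `<=` definable L by move=> P [b _ ->]; exact: deq.
have YA s' : [set: Y s'] #<= [set: A].
  have /infiniteP /card_leTP[i inji] := infA.
  apply: card_le_trans (card_setXT infA); apply/card_leTP.
  exists (fun x : Y s' => (i (nat_of_bool x.2.1), x.2.2)).
  move=> [e1 [b a]] [e2 [b' a']] /= [/inji eb ->].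
  by rewrite (Prop_irrelevance e1 e2); case: b b' eb => -[].
pose mk (K : kripke D) (x : bool * A -> dom K s) s' (z : Y s') : dom K s' :=
  match z.1 in _ = s' return dom K s' with erefl => x z.2 end.
have mkE (K : kripke D) (y : forall s', Y s' -> dom K s') :
    y = mk K (fun x => y s (erefl, x)).
  apply: functional_extensionality_dep => s'.
  by apply: functional_extensionality_dep => -[es x]; case: _ / es.
have AxE (K : kripke D) (x : bool * A -> dom K s) :
    (forall P, Ax P -> P (expand (mk K x))) <->
    [/\ forall i j, cval K (nm i) = cval K (nm j) <-> val i = val j &
        forall a b j, lim a -> olt (q a (f j)) b -> olt b a ->
          x (true, a) = cval K (nm j) -> x (false, b) = cval K (nm (e 0))].
  have vE b a : cval (expand (mk K x)) (var b a) = x (b, a).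
    by rewrite /var cval_inr.
  have nE j : cval (expand (mk K x)) (nmY j) = cval K (nm j).
    by rewrite /nmY cval_inl.
  split=> [h|[h1 h2]].
    split=> [i j|a b j la qb ba].
      split=> [ij|ij].
        apply: contrapT => nij; have : Ax (fun K => cval K (nmY i) <> cval K (nmY j)).
          by constructor 2; exists i, j.
        by move/h; apply; rewrite !nE.
      have : Ax (fun K => cval K (nmY i) = cval K (nmY j)).
        by constructor 1; exists i, j.
      by move/h; rewrite !nE.
    have : Ax (fun K => cval K (var true a) = cval K (nmY j) -> out b K).
      by constructor 3; exists a, b, j.
    by move/h; rewrite /out !vE !nE.
  move=> P [[i [j [ij ->]]]|[i [j [ij ->]]]|[a [b [j [la qb ba ->]]]]].
  - by rewrite !nE; exact/h1.
  - by rewrite !nE => /h1.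
  - by rewrite /out !vE !nE; exact: h2.
have outE (K : kripke D) (x : bool * A -> dom K s) a :
    out a (expand (mk K x)) <-> x (false, a) = cval K (nm (e 0)).
  by rewrite /out /var /nmY cval_inr cval_inl.
have satAx : exists (K : kripke D) (y : forall s', Y s' -> dom K s'),
    models K T /\ forall P, Ax P -> P (expand y).
  (* Here [U] is empty. *)
  by exists M, (mk M (fun _ => val (e 0))); split=> //; apply/AxE; split.
have := omit_or_realize regA otp sigD powD TL YA (card_lexx _) (inhabits a0) dAx dG satAx.
case=> [[K [y [KT KAx om]]]|[a1 [C [p [_ _ [_ Ap] [K [y [c [KT KAx Kp]]]] ent]]]]].
  rewrite (mkE K y) in KAx om; move: KAx om; set x := fun _ => _.
  move=> /AxE[KM Kx] om.
  (* All types are omitted, so [U] is unbounded and has a limit point [a]; but [var true a] has a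
     name, which gives a bound of [U] below [a]. *)
  have [a [r [ra rU]]] := unbounded_cofinal_seq
    (U := fun b => x (false, b) <> cval K (nm (e 0))) regA unctbl
    (fun b => match om b with ex_intro2 _ (ex_intro2 b' bb' eP) nP =>
       ex_intro2 _ _ b' bb'
         (fun xb => nP (eq_ind_r (fun P => P _) ((outE K x b').2 xb) eP)) end).
  have la : lim a by exists r.
  have [j xj] := named K KT (x (true, a)).
  have [m qr] := ra.2 _ ((qP a la).1 (f j)).
  by apply: (rU m); apply: (Kx a _ j) => //; exact: ra.1.
(* Now [p] entails a type. Since [p] depends only on variables with index below [d0], those above
   [d] can be changed so that [b] belongs to [U], which the type forbids. *)
have [d0 d0P] := bounded_support (fun s' (z : Y s') => z.2.2) regA Ap.
have [d [d0d a1d]] : exists d, ole d0 d /\ ole a1 d.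
  by have [? ?] := omaxP d0 a1; exists (omax d0 a1).
have [b db] := regular_unbounded regA d.
rewrite (mkE K y) in KAx Kp; move: KAx Kp; set x := fun _ => _.
move=> /AxE[KM Kx] Kp.
(* The new [U] has only [b] above [d]. So the bound for a limit [a] above [d] has to be at least
   [d], and beyond [b] if [b] is below [a]. *)
have /choice[n nP] : forall a, exists n, lim a -> olt d a ->
    ole d (q a n) /\ (olt b a -> olt b (q a n)).
  move=> a; have [[la da]|no] := pselect (lim a /\ olt d a); last first.
    by exists 0 => la da; case: no.
  have [ba|ab] := olt_or_ge b a.
    have [n bn] := (qP a la).2 b ba; exists n => _ _; split=> // .
    by left; exact: olt_trans db bn.
  have [n dn] := (qP a la).2 d da; exists n => _ _; split; first by left.
  by move=> /(ole_lt_trans ab) /olt_irr.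
pose x' (z : bool * A) := if `[< ole z.2 d >] then x z else
  if z.1 then cval K (nm (e (n z.2)))
  else if `[< z.2 = b >] then cval K (nm (e 1)) else cval K (nm (e 0)).
have : out b (expand (mk K x')).
  apply: (ent K (mk K x') c) => //.
  - apply/AxE; split=> // a b' j la qb ba; rewrite /x' /=.
    case: asboolP => ad; case: asboolP => bd.
    + exact: Kx.
    + by case: bd; left; exact: olt_le_trans ba ad.
    (* Equalities of names are as in [M], so the name [j] of the new bound codes [n a]. *)
    + case: (olt_or_ge d a) => // da /KM /esym /fe ej.
      have [dq _] := nP a la da.
      case: (@olt_irr A b'); apply: ole_lt_trans bd _.
      by apply: ole_lt_trans dq _; rewrite -ej.
    + case: (olt_or_ge d a) => // da /KM /esym /fe ej.
      case: asboolP => // eb; subst b'.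
      have [_ /(_ ba)] := nP a la da; rewrite -ej => bq.
      by case: (@olt_irr A b); exact: olt_trans bq qb.
  - apply: d0P Kp => s' [es [i a]] /= ad0; case: _ / es => /=.
    rewrite /mk /x' /=; case: asboolP => //; case.
    by left; exact: olt_le_trans ad0 d0d.
  - by exists b => //; exact: ole_lt_trans a1d db.
move/outE; rewrite /x' /=; case: asboolP => [/(olt_le_trans db) /olt_irr //|_].
by case: asboolP => // _ /(inje K KT).
Qed.

Lemma order_expansion (A : cardinal) (D : signature) (I : set (esort D))
    (V : kripke D) : regular A ->
  (forall s, I s -> [set: A] #<= [set: dom V s]) ->
  exists2 V' : kripke (add_order I), order_reduct V' = V &
    forall (s : esort D) (hs : I s),
      linear_order (orderI (K := V') hs) /\
      has_cofinality (orderI (K := V') hs) A.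
Proof.
move=> regA AV.
have ex_le s : exists le : dom V s -> dom V s -> Prop,
    I s -> linear_order le /\ has_cofinality le A.
  have [Is|nI] := pselect (I s); last by exists (fun _ _ => True).
  by have [le ?] := linear_order_cofinality regA (AV s Is); exists le.
pose le s := sval (cid (ex_le s)).
have leP s : I s -> linear_order (le s) /\ has_cofinality (le s) A.
  by rewrite /le; case: cid.
move: le leP => le leP.
exists (@Kripke (add_order I) (world V) (world_inh V) (@nomI _ V)
  (fun l => match l return world V -> world V -> Prop with
   | inl l => modalI (k := V) l
   | inr _ => le None
   end)
  (@rcar _ V) (@rcar_inh _ V) (@rcstI _ V) (@rfunI _ V)
  (fun n a p => match p with
   | inl p => rrelI (k := V) p
   | inr q => match q in @order_rel _ _ n a
       return (forall i, rcar V (a i)) -> Prop with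
     | OrderRel r _ => fun x => le (Some r) (x ord0) (x (lift ord0 ord0)) end
   end)
  (@flcar _ V) (@flcar_inh _ V) (@flfunI _ V) (@flrelI _ V)).
  by case: V le leP {AV ex_le}.
case=> [r|] hs; [exact (leP (Some r) hs)|exact (leP None hs)].
Qed.

Lemma upward_models (L : fragment) (A : cardinal) (D : signature)
    (T : set (sen D)) (K : kripke D) :
  closed_equality L -> closed_retrieve L -> closed_negation L ->
  closed_disjunction L -> regular A -> omitting_types_property L A ->
  fsig L D -> power_le D A -> T `<=` @fsen L D -> models K T ->
  exists2 V : kripke D, models V T &
    forall s, infinite_sorts K s -> [set: A] #<= [set: dom V s].
Proof.
move=> eqL atL negL orL regA otp sigD powD TL KT.
have infA : infinite_card A := regA.1.
have [ctbl|unctbl] := pselect ([set: A] #<= [set: nat]).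
  by exists K => // s /infiniteP; exact: card_le_trans.
have [[s0 Is0]|noI] := pselect (exists s, infinite_sorts K s); last first.
  by exists K => // s Is; case: noI; exists s.
have [a0 _] := infinite_setN0 infA.
have /infiniteP /card_leTP[iA injA] := infA.
pose I := infinite_sorts K.
(* On each infinite sort, [inl n] stands for [e_n] and [inr j] for [c_j]; [trash] says that [c_j]
   equals [e_0]. *)
pose Y (s : esort D) : Type := (I s * (nat + A))%type.
pose con s (h : I s) x : @cst (ext Y) s := cinr (C := Y) (h, x).
pose trash s (h : I s) j (V : kripke (ext Y)) :=
  cval V (con s h (inr j)) = cval V (con s h (inl 0)).
pose Ax : set (kripke (ext Y) -> Prop) := [set P |
  (exists s (h : I s) n m, n <> m /\
     P = (fun V => cval V (con s h (inl n)) <> cval V (con s h (inl m)))) \/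
  (exists s (h : I s) j k, j <> k /\ P = (fun V =>
     cval V (con s h (inr j)) = cval V (con s h (inr k)) -> trash s h j V))].
pose J := ({s | I s} * A)%type.
pose G (j : J) : set (kripke (ext Y) -> Prop) :=
  [set P | exists2 b, olt j.2 b & P = trash _ (proj2_sig j.1) b].
have sigY : fsig L (ext Y) by exact: fsig_ext.
have deq := definable_eq eqL atL sigY.
have dAx : Ax `<=` definable L.
  move=> P [[s [h [n [m [_ ->]]]]]|[s [h [j [k [_ ->]]]]]].
    by apply: definable_neg => //; exact: deq.
  by apply: definable_imp => //; exact: deq.
have dG j : G j `<=` definable L by move=> P [b _ ->]; exact: deq.
have YA s : [set: Y s] #<= [set: A].
  have natA : [set: nat] #<= [set: A] by apply/infiniteP.
  apply: card_le_trans (card_le_sum infA natA (card_lexx _)); apply/card_leTP.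
  by exists snd => -[h x] [h' x'] /= ->; rewrite (Prop_irrelevance h h').
have JA : [set: J] #<= [set: A].
  have /card_leTP[i inji] := card_esort powD.
  apply: card_le_trans (card_setXT infA); apply/card_leTP.
  exists (fun j : J => (i (sval j.1), j.2)) => -[[s h] j] [[s' h'] j'] /=.
  by move=> [/inji es ->]; subst s'; rewrite (Prop_irrelevance h h').
have AxE (V : kripke D) (y : forall s, Y s -> dom V s) :
    (forall P, Ax P -> P (expand y)) <-> forall s (h : I s),
    injective (fun n => y s (h, inl n)) /\
    forall j k, j <> k -> y s (h, inr j) = y s (h, inr k) ->
      y s (h, inr j) = y s (h, inl 0).
  have cE s (h : I s) x : cval (expand y) (con s h x) = y s (h, x).
    by rewrite /con cval_inr.
  split=> [ax s h|ax P [[s [h [n [m [nm ->]]]]]|[s [h [j [k [jk ->]]]]]]].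
  - split=> [n m nm|j k jk].
      apply: contrapT => nnm; have : Ax (fun V =>
          cval V (con s h (inl n)) <> cval V (con s h (inl m))).
        by left; exists s, h, n, m.
      by move/ax; apply; rewrite !cE.
    have : Ax (fun V => cval V (con s h (inr j)) = cval V (con s h (inr k)) ->
        trash s h j V).
      by right; exists s, h, j, k.
    by move/ax; rewrite /trash !cE.
  - by rewrite !cE => /(ax s h).1.
  - by rewrite /trash !cE; exact: (ax s h).2.
have trashE (V : kripke D) (y : forall s, Y s -> dom V s) s h j :
    trash s h j (expand y) <-> y s (h, inr j) = y s (h, inl 0).
  by rewrite /trash /con !cval_inr.
have satAx : exists (V : kripke D) (y : forall s, Y s -> dom V s),
    models V T /\ forall P, Ax P -> P (expand y).
  have inf s (h : I s) : exists i : nat -> dom K s, injective i.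
    by apply/card_leTP/infiniteP.
  pose i s h := sval (cid (inf s h)).
  have inji s h : injective (i s h) by rewrite /i; case: cid.
  (* All the [c_j] take the value of [e_0]. *)
  exists K, (fun s z => i s z.1 (if z.2 is inl n then n else 0)); split=> //.
  by apply/AxE => s h; split=> [n m /inji|].
have := omit_or_realize regA otp sigD powD TL YA JA
  (inhabits (exist _ s0 Is0, a0)) dAx dG satAx.
case=> [[V [y [VT /AxE Vy om]]]|
  [[[s h] a1] [C [p [CA pL [_ Ap] [V [y [c [VT VAx Vp]]]] ent]]]]].
  exists V => // s h.
  (* Omission makes the indices of the [c_j] different from [e_0] unbounded, hence [A] many, and
     such [c_j] are pairwise distinct. *)
  pose U := [set j | y s (h, inr j) <> y s (h, inl 0)].
  have unbU : [set: A] #<= U.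
    apply: regA.2.2 => b; have [P [b' bb' ->] nP] := om (exist _ s h, b).
    by exists b'; [move=> e; apply: nP; apply/trashE|left].
  apply: (card_le_trans unbU); apply: (@fun_card_le _ _ _ _ (fun j => y s (h, inr j))) => //.
  move=> j k Uj _ ejk; apply: contrapT => jk; apply: Uj.
  exact: (Vy s h).2 jk ejk.
exfalso.
pose idx s' (z : Y s') := if z.2 is inr j then j else a0.
have [d dP] := bounded_support idx regA Ap.
pose D1 := ext C.
(* In every model of this theory all elements of sort [s] turn out to be named, which
   [named_sort_absurd] excludes. *)
pose T1 : set (sen D1) :=
  mor_sen (ext_incl C) @` (mor_sen (ext_incl Y) @` T `|` sens L Ax) `|` p.
have T1E (V1 : kripke D1) : models V1 T1 -> exists V2 y2 c2,
    [/\ V1 = @expand (ext Y) (@expand D V2 Y y2) C c2, models V2 T,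
        forall P, Ax P -> P (expand y2) & models (@expand (ext Y) (expand y2) C c2) p].
  have [V1' [c2 eV]] := kripke_extE V1; subst V1.
  have [V2 [y2 eV]] := kripke_extE V1'; subst V1'.
  move=> /modelsU[/models_ext_incl /modelsU[/models_ext_incl V2T /models_sens V2Ax] V2p].
  by exists V2, y2, c2; split=> //; exact: V2Ax.
have powY := power_le_ext powD YA.
pose nm x : @cst D1 s := cinl C (con s h x).
have nmE V2 y2 c2 x :
    cval (@expand (ext Y) (@expand D V2 Y y2) C c2) (nm x) = y2 s (h, x).
  by rewrite /nm cval_inl /con cval_inr.
apply: (@named_sort_absurd L A D1 T1 s _ nm inl) => //.
- exact: fsig_ext.
- by apply: power_le_ext => // s'; case: (CA s').
- move=> phi [|/pL //]; apply: fsen_ext_incl => // psi [|[] //].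
  exact: fsen_ext_incl.
- exists (@expand (ext Y) (expand y) C c); apply/modelsU; split=> //.
  apply/models_ext_incl/modelsU; split; first exact/models_ext_incl.
  exact/models_sens.
- move=> _ /T1E[V2 [y2 [c2 [-> V2T V2Ax V2p]]]] u.
  have := (AxE V2 y2).1 V2Ax => ax.
  apply: contrapT => nu; have {}nu x : y2 s (h, x) <> u.
    by move=> e; apply: nu; exists x; rewrite nmE.
  have [b [db ab]] : exists b, olt d b /\ olt a1 b.
    have [? ?] := omaxP d a1; have [b lb] := regular_unbounded regA (omax d a1).
    by exists b; split; apply: ole_lt_trans lb.
  (* The valuation is changed uniformly in all infinite sorts, so an unnamed element is chosen in
     each sort that has one, with [e_0] as default. *)
  pose new s' (h' : I s') := if pselect (exists u', forall x, y2 s' (h', x) <> u')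
    is left E then sval (cid E) else y2 s' (h', inl 0).
  have newP s' (h' : I s') j : y2 s' (h', inr j) = new s' h' ->
      y2 s' (h', inr j) = y2 s' (h', inl 0).
    by rewrite /new; case: pselect => // E; case: cid => /= u' /(_ (inr j)).
  (* Values with index below [d] are kept for the sake of [p], [c_b] moves to the unnamed element
     and the other [c_j] to [e_0], so that the axioms survive. The type then forces [c_b] to equal
     [e_0]. *)
  pose y3 s' (z : Y s') : dom V2 s' := match z.2 with
    | inl n => y2 s' z
    | inr j => if `[< olt j d >] then y2 s' z
        else if `[< j = b >] then new s' z.1 else y2 s' (z.1, inl 0) end.
  have : trash s h b (expand y3).
    apply: (ent V2 y3 c2) => //.
    + apply/AxE => s' h'; split; first exact: (ax s' h').1.
      have ax2 := (ax s' h').2 => j k jk; rewrite /y3 /=.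
      case: (asboolP (olt j d)) => jd; case: (asboolP (olt k d)) => kd.
      * exact: ax2.
      * by case: asboolP => // _ /newP.
      * by case: asboolP => // _ /esym e; rewrite -e; exact: (newP _ _ _ e).
      * case: asboolP => // jb; case: asboolP => // kb.
        by case: jk; rewrite jb kb.
    + apply: dP V2p => s' [h' [n|j]] //=; rewrite /y3 /idx /=.
      by case: asboolP.
    + by exists b.
  move/trashE; rewrite /y3 /=; case: asboolP => [bd|_].
    by case: (@olt_irr A b); exact: olt_trans bd db.
  case: asboolP => // _; rewrite /new; case: pselect => [E|[]]; last by exists u.
  by case: cid => u' /= nu' e; exact: (nu' (inl 0)).
- by move=> _ /T1E[V2 [y2 [c2 [-> _ /AxE ax _]]]] n m; rewrite !nmE => /(ax s h).1.
Qed.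

Theorem theorem53 (L : fragment) (A : cardinal) (D : signature)
    (T : set (sen D)) (K : kripke D) :
  closed_equality L -> closed_retrieve L -> closed_negation L ->
  closed_disjunction L -> closed_possibility L -> closed_quantifiers L ->
  regular A -> omitting_types_property L A ->
  fsig L D -> power_le D A ->
  T `<=` @fsen L D -> satisfiable T -> models K T ->
  exists V : kripke D,
    [/\ models V T,
        forall s : esort D, infinite_sorts K s ->
          [set: A] #<= [set: dom V s]
      & exists2 V' : kripke (add_order (infinite_sorts K)),
          order_reduct V' = V &
          forall (s : esort D) (hs : infinite_sorts K s),
            linear_order (orderI (K := V') hs) /\
            has_cofinality (orderI (K := V') hs) A].
Proof.
move=> eqL atL negL orL _ _ regA otp sigD powD TL _ KT.
have [V VT AV] := upward_models eqL atL negL orL regA otp sigD powD TL KT.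
by exists V; split=> //; exact: order_expansion.
Qed.
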